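(* Let $L_1$ and $L_2$ be finite permutation groups with the following properties: (1) $\mathcal{O}(L_1)$ and $\mathcal{O}(L_2)$ are transitive, and (2) $[L_1,L_2]$ is locally-restrictive. Then the set of orders of finite graphs $\Gamma$ for which there exists some group $G$ such that $(\Gamma,G)$ is a locally-$[L_1,L_2]$ pair has natural density $0$.
   Context: All graphs and groups are finite. A graph $\Gamma$ consists of a set of vertices $V(\Gamma)$ and a set of edges $E(\Gamma)$, which is a set of $2$-element subsets of $V(\Gamma)$; its order is $|V(\Gamma)|$. $\mathrm{Aut}(\Gamma)$ is the group of permutations of $V(\Gamma)$ preserving $E(\Gamma)$. For a vertex $v$ and $G\leq\mathrm{Aut}(\Gamma)$, $G_v$ is the stabiliser of $v$ in $G$, $\Gamma(v)$ is the set of neighbours of $v$, and $G_v^{\Gamma(v)}$ is the permutation group induced by $G_v$ on $\Gamma(v)$. For a group $L$, $\mathcal{O}(L)$ denotes the subgroup of $L$ generated by the elements of odd order. For transitive permutation groups $L_1,L_2$, let $[L_1,L_2]$ denote the multiset containing $L_1$ and $L_2$. A pair $(\Gamma,G)$ is a locally-$[L_1,L_2]$ pair if $\Gamma$ is a connected graph, $G\leq\mathrm{Aut}(\Gamma)$, and for some edge $\{u,v\}$ of $\Gamma$ there are permutation isomorphisms $G_u^{\Gamma(u)}\cong L_1$ and $G_v^{\Gamma(v)}\cong L_2$. The multiset $[L_1,L_2]$ is locally-restrictive if there exists a positive integer $a$ such that for every locally-$[L_1,L_2]$ pair $(\Gamma,G)$ and every $v\in V(\Gamma)$ we have $|G_v|\leq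 a$. A set $X$ of positive integers has natural density $0$ if $\lim_{n\to\infty}\frac{|X\cap\{1,\ldots,n\}|}{n}=0$. *)

(* Defs.v *)
From HB Require Import structures.
From mathcomp Require Import all_boot all_order all_algebra all_fingroup.
From mathcomp Require Import boolp classical_sets reals topology normedtype sequences.

Set Implicit Arguments.
Unset Strict Implicit.
Unset Printing Implicit Defensive.

Import numFieldNormedType.Exports.

Record sgraph := SGraph {
  vertex :> finType;
  adj : rel vertex;
  adj_sym : symmetric adj;
  adj_irrefl : irreflexive adj }.

Arguments adj {Gamma} : rename.

Definition nbhd (Gamma : sgraph) (v : Gamma) : {set Gamma} :=
  [set w | adj v w]%SET.

Definition graph_connected (Gamma : sgraph) : Prop :=
  forall x y : Gamma, connect adj x y.

Definition graph_aut (Gamma : sgraph) : {set {perm Gamma}} :=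
  [set s : {perm Gamma} | [forall x, forall y, adj (s x) (s y) == adj x y]]%SET.

Lemma graph_autP (Gamma : sgraph) (s : {perm Gamma}) :
  reflect (forall x y, adj (s x) (s y) = adj x y) (s \in graph_aut Gamma).
Proof.
rewrite inE; apply: (iffP forallP) => [H x y|H x].
  by apply/eqP; apply: (forallP (H x)).
by apply/forallP => y; apply/eqP.
Qed.

Lemma graph_aut_group_set (Gamma : sgraph) : group_set (graph_aut Gamma).
Proof.
apply/group_setP; split=> [|s t /graph_autP Hs /graph_autP Ht].
  by apply/graph_autP => x y; rewrite !perm1.
by apply/graph_autP => x y; rewrite !permM Ht Hs.
Qed.

Canonical graph_aut_group (Gamma : sgraph) : {group {perm Gamma}} :=
  group (graph_aut_group_set Gamma).

(* G_v^{Gamma(v)}, realized inside {perm Gamma} as a group of permutations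
   supported on Gamma(v).  restr_perm S sends a permutation that does not
   preserve S to 1, but for G \subset graph_aut Gamma every element of G_v
   preserves Gamma(v). *)
Definition local_group (Gamma : sgraph) (G : {group {perm Gamma}}) (v : Gamma) :
    {group {perm Gamma}} :=
  (restr_perm (nbhd v) @* 'C_G[v | 'P])%G.

(* H is viewed as a permutation group on the subset S of T that it preserves,
   and L as a permutation group on the whole of Omega. *)
Definition perm_isomorphic (T Omega : finType) (S : {set T})
    (H : {group {perm T}}) (L : {group {perm Omega}}) : Prop :=
  exists (f : Omega -> T) (phi : {morphism L >-> {perm T}}),
    [/\ injective f,
        (f @: [set: Omega] = S)%SET,
        isom L H phi
      & forall (s : {perm Omega}) (x : Omega), s \in L -> f (s x) = phi s (f x)].

Definition odd_core (gT : finGroupType) (L : {group gT}) : {group gT} :=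
  <<[set x in L | odd #[x]%g]%SET>>%G.

(* The edge {u, v} is unordered (adj is symmetric), so this predicate is
   symmetric in L1 and L2, as required for a multiset [L1, L2]. *)
Definition locally_pair (Omega1 Omega2 : finType)
    (L1 : {group {perm Omega1}}) (L2 : {group {perm Omega2}})
    (Gamma : sgraph) (G : {group {perm Gamma}}) : Prop :=
  [/\ graph_connected Gamma,
      G \subset graph_aut Gamma
    & exists u v : Gamma,
        [/\ adj u v,
            perm_isomorphic (nbhd u) (local_group G u) L1
          & perm_isomorphic (nbhd v) (local_group G v) L2]].

Definition locally_restrictive (Omega1 Omega2 : finType)
    (L1 : {group {perm Omega1}}) (L2 : {group {perm Omega2}}) : Prop :=
  exists a : nat, 0 < a /\
    forall (Gamma : sgraph) (G : {group {perm Gamma}}),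
      locally_pair L1 L2 G -> forall v : Gamma, #|'C_G[v | 'P]%g| <= a.

Definition locally_pair_orders (Omega1 Omega2 : finType)
    (L1 : {group {perm Omega1}}) (L2 : {group {perm Omega2}}) : set nat :=
  [set n | exists Gamma : sgraph,
     #|Gamma| = n /\ exists G : {group {perm Gamma}}, locally_pair L1 L2 G]%classic.

Definition natural_density_zero (R : realType) (X : set nat) : Prop :=
  ((\sum_(1 <= k < n.+1) (`[< X k >] : nat))%N%:R / n%:R @[n --> \oo]
     --> (0 : R))%classic%R.

(* Main.v *)
Require Import Defs.
From mathcomp Require Import all_boot all_order all_algebra all_fingroup.
From mathcomp Require Import all_solvable all_field.
From mathcomp Require Import boolp classical_sets reals topology normedtype sequences.
From mathcomp Require Import exp complex zify ring lra.

Set Implicit Arguments.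
Unset Strict Implicit.
Unset Printing Implicit Defensive.

(** Let (Gamma, G) be a locally-[L1, L2] pair with vertex stabilisers of order at most a, and
    let K be generated by the elements of odd order of G_u and G_v.  Elements of odd order of
    the local groups lift to elements of odd order, so K is still transitive on the
    neighbourhoods of u and v; hence K has at most two orbits on vertices, and
    |Gamma| = |K| / i or |K| (1/i + 1/j) with i, j <= a.

    Call a prime p > a isolated for N if p divides N exactly once, no divisor d > 1 of N is
    1 modulo p, and p is not 1 modulo any odd prime r <= a.  There is none for N = |K|: by
    Sylow's theorem the Sylow p-subgroup P would be normal, the generators, whose orders are
    coprime to p (p - 1), would centralise P, and by Schur-Zassenhaus K = P x C with all the
    generators in C.

    Almost every N has an isolated prime.  By Turan's variance argument almost every
    N <= x is divisible by some prime p > (log x)^2 from any given set of primes p <= x for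
    which the sum of 1/p over this range tends to infinity, while p^2 or p d with d > 1,
    d = 1 mod p, rarely divides N.
    The required lower bound on the sum of 1/p over the primes that are not 1 modulo any r
    does not need L(1, chi) <> 0.  If beta is the indicator function of this set of residues,
    normalised to have mean 1, then beta - 1/2 sum_chi chi has the Fourier coefficient 1/2 at
    the principal character and nonpositive ones elsewhere, and is at most 0 off the set; so
    it suffices to bound Re sum_p chi(p) p^-s from above for nonprincipal chi, which follows
    from the boundedness of L(s, chi) as s -> 1+. *)

Import Order.TTheory GRing.Theory Num.Theory numFieldNormedType.Exports.
Local Open Scope ring_scope.

(** * Sieving sums of completely multiplicative functions *)

Lemma prime_coprime_fact (p y : nat) : prime p -> (y < p)%N -> coprime p y`!.
Proof.
move=> pp; elim: y => [|y IHy] ltyp; first by rewrite coprimen1.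
by rewrite factS coprimeMr IHy 1?ltnW // andbT prime_coprime // gtnNdvd.
Qed.

(** A prime common to [n] and a nonprime [y.+1] is at most [y], so it already divides the factorial
    of [y]. *)
Lemma coprime_factS_composite (n y : nat) :
  ~~ prime y.+1 -> coprime n y.+1`! = coprime n y`!.
Proof.
move=> npr; rewrite factS coprimeMr andb_idl //; apply: contraTT => ncop.
have g1 : (1 < gcdn n y.+1)%N.
  by rewrite ltn_neqAle eq_sym gcdn_gt0 orbT andbT -/(coprime n y.+1).
have [p pp] := pdivP g1; rewrite dvdn_gcd => /andP[pn py].
have ley : (p <= y)%N.
  rewrite -ltnS ltn_neqAle dvdn_leq // andbT.
  by apply: contraNneq npr => <-.
have pf : (p %| y`!)%N by apply: dvdn_fact; rewrite prime_gt0.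
apply/negP => /eqP cop; move: pp; have := dvdn_gcd p n y`!.
by rewrite pn pf cop dvdn1 => /eqP ->.
Qed.

Lemma sum_multiples (V : nmodType) (F : nat -> V) (P : pred nat) (q X : nat) :
  (0 < q)%N ->
  \sum_(1 <= n < X.+1 | (q %| n)%N && P n) F n =
  \sum_(1 <= k < (X %/ q).+1 | P (q * k)%N) F (q * k)%N.
Proof.
move=> q0; rewrite -big_filter_cond -[RHS](big_map (fun k => (q * k)%N) P F).
apply: perm_big; apply: uniq_perm.
- exact/filter_uniq/iota_uniq.
- rewrite map_inj_uniq ?iota_uniq // => k l /eqP.
  by rewrite eqn_mul2l gtn_eqF //= => /eqP.
move=> n; rewrite mem_filter mem_index_iota; apply/andP/mapP.
  case=> /dvdnP[k ->] /andP[k1 kX]; exists k; last by rewrite mulnC.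
  rewrite mem_index_iota ltnS leq_divRL // -[(k * q <= X)%N]ltnS kX andbT.
  by move: k1; rewrite muln_gt0 => /andP[].
case=> k; rewrite mem_index_iota => /andP[k1 kX ->].
by rewrite dvdn_mulr // muln_gt0 q0 k1 /= ltnS mulnC -leq_divRL.
Qed.

(** Coprimality with the factorial of [y] encodes that [n] has no prime factor at most [y]; for
    [y = 0] the sum is unrestricted. *)
Definition rough_sum (F : nmodType) (f : nat -> F) (y X : nat) : F :=
  \sum_(1 <= n < X.+1 | coprime n y`!) f n.

(** Legendre's step: the multiples [q * k] of the prime [q = y.+1] are taken out, and [q * k] is
    coprime to the factorial of [y] exactly when [k] is. *)
Lemma rough_sum_prime (F : numFieldType) (f : nat -> F) (y X : nat) :
  {morph f : m n / (m * n)%N >-> m * n} -> prime y.+1 ->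
  rough_sum f y.+1 X = rough_sum f y X - f y.+1 * rough_sum f y (X %/ y.+1).
Proof.
move=> fM qpr; set q := y.+1; apply/eqP; rewrite eq_sym subr_eq.
rewrite /rough_sum (bigID (fun n => q %| n)%N) /= addrC; apply/eqP; congr (_ + _).
  by apply: eq_bigl => n; rewrite factS coprimeMr andbC -prime_coprime 1?coprime_sym.
under eq_bigl do rewrite andbC; rewrite sum_multiples // big_distrr /=.
apply: eq_big => [k|k _]; last exact: fM.
by rewrite coprimeMl andb_idl // => _; rewrite prime_coprime_fact.
Qed.

(** Absolute convergence as a Cauchy criterion, so that no infinite sum is formed. *)
Definition small_tails (F : numFieldType) (f : nat -> F) :=
  forall e : F, 0 < e -> exists X0, forall X Y, (X0 <= X)%N ->
    \sum_(X.+1 <= n < Y.+1) `|f n| <= e.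

Lemma rough_sum_tail (F : numFieldType) (f : nat -> F) (y X Y : nat) (e : F) :
  (Y <= X)%N -> \sum_(Y.+1 <= n < X.+1) `|f n| <= e ->
  `|rough_sum f y X - rough_sum f y Y| <= e.
Proof.
move=> leYX; apply: le_trans; rewrite /rough_sum (big_cat_nat (n := Y.+1)) //=.
rewrite addrC addKr; apply: le_trans (ler_norm_sum _ _ _) _.
by rewrite big_mkcond /=; apply: ler_sum => n _; case: ifP.
Qed.

(** A finite Euler product: each factor [1 - f p] sieves out the multiples of [p]. Legendre's step
    yields a sum up to [X %/ p] where the product needs one up to [X]; the difference is a tail. *)
Lemma euler_sieve (F : numFieldType) (f : nat -> F) :
  {morph f : m n / (m * n)%N >-> m * n} -> (forall n, `|f n| <= 1) ->
  small_tails f ->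
  forall y (e : F), 0 < e -> exists X0, forall X, (X0 <= X)%N ->
  `|rough_sum f 0 X * \prod_(1 <= p < y.+1 | prime p) (1 - f p) - rough_sum f y X| <= e.
Proof.
move=> fM f1 ft; elim=> [|y IHy] e e0.
  by exists 0%N => X _; rewrite big_geq // mulr1 subrr normr0 ltW.
rewrite big_mkcond big_nat_recr //= -big_mkcond /=.
have [qpr|nqpr] := boolP (prime y.+1); last first.
  have [X0 HX] := IHy e e0; exists X0 => X /HX; rewrite mulr1.
  by congr (`|_ - _| <= _); apply: eq_bigl => n; rewrite coprime_factS_composite.
have e4 : 0 < e / 3 by rewrite divr_gt0.
have [X0 HX] := IHy _ e4; have [X1 HX1] := ft _ e4.
(* The bound [X1 * y.+1] makes [X %/ y.+1] at least [X1]. The factor [1 - f q] at most doubles the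
   old error [e / 3], and the tail adds the last third. *)
exists (maxn X0 (X1 * y.+1)) => X; rewrite geq_max => /andP[/HX HX0 leX1].
rewrite rough_sum_prime //; set P := \prod_(_ <= _ < _ | _) _ in HX0 *.
set q := y.+1 in leX1 *; set S0 := rough_sum f 0 X in HX0 *.
have := rough_sum_tail (f := f) y (leq_div X q) (HX1 _ _ _).
rewrite leq_divRL // => /(_ leX1).
set S := rough_sum f y X in HX0 *; set S' := rough_sum f y _ => HS.
have -> : S0 * (P * (1 - f q)) - (S - f q * S') =
  (S0 * P - S) * (1 - f q) - f q * (S - S') by ring.
apply: le_trans (ler_normB _ _) _; rewrite !normrM.
have -> : e = e / 3 * 2 + 1 * (e / 3) by field.
apply: lerD; apply: ler_pM => //.
by apply: le_trans (ler_normB _ _) _; rewrite normr1 lerD2l.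
Qed.

(** Every [n] with [1 < n <= y] divides the factorial of [y], so only [n = 1] survives. *)
Lemma rough_sum_id (F : nmodType) (f : nat -> F) (y : nat) : (0 < y)%N -> rough_sum f y y = f 1%N.
Proof.
move=> y0; rewrite /rough_sum big_ltn_cond // coprime1n big_nat_cond big_pred0 ?addr0 // => n.
rewrite andbC; apply/negP => /andP[cop /andP[n1 ny]].
have /gcdn_idPl : (n %| y`!)%N by apply: dvdn_fact; rewrite (ltnW n1).
by rewrite (eqP cop) => en; rewrite -en in n1.
Qed.

(** * Estimates for the terms n^-(1+h) of the zeta series *)

Definition zeta_term (R : realType) (h : R) (n : nat) : R := n%:R `^ (- (1 + h)).

Lemma zeta_termM (R : realType) (h : R) : {morph zeta_term h : m n / (m * n)%N >-> m * n}.
Proof. by move=> m n; rewrite /zeta_term natrM powRM. Qed.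

Lemma zeta_term0 (R : realType) (h : R) : 0 < h -> zeta_term h 0 = 0.
Proof. by move=> h0; rewrite /zeta_term powR0 // oppr_eq0 gt_eqF // addr_gt0. Qed.

Lemma zeta_term1 (R : realType) (h : R) : zeta_term h 1 = 1.
Proof. exact: (congr1 (fun f => f _) (powR1 R)). Qed.

Lemma zeta_term_ge0 (R : realType) (h : R) n : 0 <= zeta_term h n.
Proof. exact: powR_ge0. Qed.

Lemma zeta_term_homo (R : realType) (h : R) m n :
  0 < h -> (0 < m <= n)%N -> zeta_term h n <= zeta_term h m.
Proof.
move=> h0 /andP[m0 mn]; have n0 := leq_trans m0 mn.
rewrite /zeta_term !powRN lef_pV2 ?posrE ?powR_gt0 ?ltr0n //.
by apply: ge0_ler_powR; rewrite ?nnegrE ?ler0n ?ler_nat // ltW // addr_gt0.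
Qed.

Lemma zeta_term_le1 (R : realType) (h : R) n : 0 < h -> zeta_term h n <= 1.
Proof.
move=> h0; case: n => [|n]; first by rewrite zeta_term0.
by rewrite -(zeta_term1 h) zeta_term_homo.
Qed.

Lemma zeta_termE (R : realType) (h : R) n : 0 < h -> zeta_term h n = n%:R `^ (- h) / n%:R.
Proof.
move=> h0; case: n => [|n]; first by rewrite zeta_term0 // invr0 mulr0.
rewrite /zeta_term opprD addrC powRD; last by rewrite pnatr_eq0 implybT.
by rewrite powR_inv1.
Qed.

(* Convexity of n |-> n^-h. *)
Lemma zeta_term_increment_lower (R : realType) (h : R) n : 0 < h -> (0 < n)%N ->
  n%:R `^ (- h) - n.+1%:R `^ (- h) <= h * zeta_term h n.
Proof.
move=> h0 n0; have nR : 0 < n%:R :> R by rewrite ltr0n.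
have -> : n.+1%:R = n%:R * (1 + n%:R^-1) :> R by rewrite mulrDr mulr1 mulfV ?gt_eqF // natr1.
have p1 : 0 < 1 + n%:R^-1 :> R by rewrite addr_gt0 ?invr_gt0.
rewrite powRM ?ler0n ?(ltW p1) // zeta_termE //.
have H : 1 - h / n%:R <= (1 + n%:R^-1) `^ (- h) :> R.
  rewrite /powR gt_eqF //; apply: le_trans (expR_ge1Dx _).
  rewrite lerD2l mulNr lerN2 ler_wpM2l ?(ltW h0) //.
  by apply: le_ln1Dx; rewrite (lt_trans (ltrN10 _)) ?invr_gt0.
have := ler_wpM2l (powR_ge0 n%:R (- h)) H.
set a := _ `^ _; set b := _ `^ _; set c := n%:R^-1; nra.
Qed.

(** The same convexity, with the tangent at [n.+1] instead of the one at [n]. *)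
Lemma zeta_term_increment_upper (R : realType) (h : R) n : 0 < h -> (0 < n)%N ->
  h * zeta_term h n.+1 <= n%:R `^ (- h) - n.+1%:R `^ (- h).
Proof.
move=> h0 n0; have nR : 0 < n%:R :> R by rewrite ltr0n.
have mR : 0 < n.+1%:R :> R by rewrite ltr0n.
have n1 : n.+1%:R^-1 < 1 :> R by rewrite invf_lt1 // ltr1n.
have -> : n%:R = n.+1%:R * (1 - n.+1%:R^-1) :> R.
  by rewrite mulrBr mulr1 mulfV ?gt_eqF // -[n.+1]addn1 natrD addrK.
have p1 : 0 < 1 - n.+1%:R^-1 :> R by rewrite subr_gt0.
rewrite powRM ?ler0n ?(ltW p1) // zeta_termE //.
have H : 1 + h / n.+1%:R <= (1 - n.+1%:R^-1) `^ (- h) :> R.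
  rewrite /powR gt_eqF //; apply: le_trans (expR_ge1Dx _).
  rewrite lerD2l mulNr -mulrN ler_wpM2l ?(ltW h0) //.
  by rewrite lerNr; apply: le_ln1Dx; rewrite ltrN2.
have := ler_wpM2l (powR_ge0 n.+1%:R (- h)) H.
set a := _ `^ _; set b := _ `^ _; set c := n.+1%:R^-1; nra.
Qed.

(** Telescoping the increments of [n^-h] replaces the integral test. *)
Lemma sum_zeta_term_tail (R : realType) (h : R) X Y : 0 < h -> (0 < X)%N ->
  \sum_(X.+1 <= n < Y.+1) zeta_term h n <= X%:R `^ (- h) / h.
Proof.
move=> h0 X0; rewrite ler_pdivlMr // mulrC mulr_sumr.
have [YX|XY] := leqP Y X; first by rewrite big_geq ?powR_ge0.
rewrite big_add1 /=; apply: le_trans (_ : \sum_(X <= i < Y) (i%:R `^ (- h) - i.+1%:R `^ (- h)) <= _).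
  by apply: ler_sum_nat => i /andP[Xi _]; apply: zeta_term_increment_upper; rewrite ?(leq_trans X0).
under eq_bigr do rewrite -opprB.
rewrite sumrN (@telescope_sumr _ X Y (fun i => i%:R `^ (- h))) ?(ltnW XY) //.
by rewrite opprB lerBlDr lerDl powR_ge0.
Qed.

Lemma sum_zeta_term_le (R : realType) (h : R) X : 0 < h ->
  \sum_(1 <= n < X.+1) zeta_term h n <= 1 + h^-1.
Proof.
move=> h0; case: X => [|X]; first by rewrite big_geq // addr_ge0 ?invr_ge0 // ltW.
rewrite big_ltn // zeta_term1 lerD2l; apply: le_trans (sum_zeta_term_tail _ h0 _) _ => //.
by rewrite (congr1 (fun f => f _) (powR1 R)) mul1r.
Qed.

Lemma sum_zeta_term_ge (R : realType) (h : R) X : 0 < h ->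
  (1 - X.+1%:R `^ (- h)) / h <= \sum_(1 <= n < X.+1) zeta_term h n.
Proof.
move=> h0; rewrite ler_pdivrMr // mulrC mulr_sumr.
apply: le_trans (_ : \sum_(1 <= i < X.+1) (i%:R `^ (- h) - i.+1%:R `^ (- h)) <= _); last first.
  by apply: ler_sum_nat => i /andP[Xi _]; apply: zeta_term_increment_lower.
under eq_bigr do rewrite -opprB.
rewrite sumrN (@telescope_sumr _ 1 X.+1 (fun i => i%:R `^ (- h))) //.
by rewrite opprB (congr1 (fun f => f _) (powR1 R)).
Qed.

Lemma powRN_small (R : realType) (h e : R) : 0 < h -> 0 < e ->
  exists X0, forall X, (X0 <= X)%N -> (0 < X)%N /\ X%:R `^ (- h) <= e.
Proof.
(* [t] is the solution of [t^-h = e]. *)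
move=> h0 e0; pose t : R := expR (ln e^-1 / h).
have t0 : 0 < t by exact: expR_gt0.
exists (Num.bound t) => X leX.
have tX : t <= X%:R.
  rewrite (le_trans (ltW (archi_boundP (ltW t0)))) // ler_nat //.
have X0 : 0 < X%:R :> R by exact: lt_le_trans tX.
split; first by rewrite -(ltr0n R).
rewrite powRN -[e]invrK lef_pV2 ?posrE ?powR_gt0 ?invr_gt0 //.
have -> : e^-1 = t `^ h.
  by rewrite /powR gt_eqF // expRK mulrC divfK ?gt_eqF // lnK // posrE invr_gt0.
by apply: ge0_ler_powR; rewrite ?nnegrE ?(ltW t0) ?(ltW X0) ?(ltW h0).
Qed.

(** Each square is at most the term for [h = 1], and those terms sum to at most [1 + 1^-1]. *)
Lemma sum_zeta_term_sq_le (R : realType) (h : R) (P : pred nat) (y : nat) : 0 < h ->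
  \sum_(1 <= p < y.+1 | P p) zeta_term h p ^+ 2 <= 2.
Proof.
move=> h0; apply: le_trans (_ : \sum_(1 <= p < y.+1) zeta_term 1 p <= _); last first.
  by apply: le_trans (sum_zeta_term_le _ _) _ => //; rewrite invr1; lra.
rewrite big_mkcond; apply: ler_sum_nat => -[|n] // _; case: ifP => _; last exact: zeta_term_ge0.
rewrite -powR_mulrn ?zeta_term_ge0 // /zeta_term -powRrM; apply: ler_powR; first by rewrite ler1n.
lra.
Qed.

(** * Dirichlet series over the primes *)

Local Open Scope complex_scope.

Lemma norm_real_complex (R : rcfType) (x : R) : `|x%:C| = `|x|%:C :> R[i].
Proof. by rewrite normc_def /= expr0n addr0 sqrtr_sqr. Qed.

Lemma small_tails_zeta_term (R : realType) (h : R) (f : nat -> R[i]) : 0 < h ->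
  (forall n, `|f n| <= (zeta_term h n)%:C) -> small_tails f.
Proof.
move=> h0 fw e; case: e => a b; rewrite ltcE /= => /andP[/eqP-> a0].
have [X0 HX] := powRN_small h0 (mulr_gt0 a0 h0).
exists X0 => X Y /HX[X1 XY]; apply: le_trans (_ : \sum_(X.+1 <= n < Y.+1) (zeta_term h n)%:C <= _).
  by apply: ler_sum.
rewrite -rmorph_sum lecR (le_trans (sum_zeta_term_tail _ h0 X1)) // ler_pdivrMr //.
Qed.

(** Summation by parts: the differences [w n - w n.+1] are nonnegative and, together with [w X.+1],
    add up to [w 1]. *)
Lemma norm_sum_decreasing (R : realType) (c : nat -> R[i]) (w : nat -> R) (B : R) (X : nat) :
  (forall N, `|\sum_(1 <= n < N.+1) c n| <= B%:C) ->
  (forall n, (0 < n)%N -> 0 <= w n.+1 <= w n) ->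
  `|\sum_(1 <= n < X.+1) c n * (w n)%:C| <= (B * w 1%N)%:C.
Proof.
move=> cB wd; have w0 n : (0 < n)%N -> 0 <= w n.
  by move=> /wd/andP[]; apply: le_trans.
pose A n := \sum_(1 <= k < n.+1) c k.
have -> : \sum_(1 <= n < X.+1) c n * (w n)%:C = A X * (w X.+1)%:C +
    \sum_(1 <= n < X.+1) A n * (w n - w n.+1)%:C.
  elim: X => [|X IHX]; first by rewrite /A !big_geq // mul0r addr0.
  rewrite [LHS]big_nat_recr //= [X in _ = _ + X]big_nat_recr //= IHX.
  have -> : A X.+1 = A X + c X.+1 by rewrite /A big_nat_recr.
  by rewrite rmorphB /=; ring.
have -> : w 1%N = w X.+1 + \sum_(1 <= n < X.+1) (w n - w n.+1).
  elim: X => [|X IHX]; first by rewrite big_geq ?addr0.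
  by rewrite big_nat_recr //= IHX; ring.
apply: le_trans (ler_normD _ _) _.
rewrite mulrDr rmorphD mulr_sumr rmorph_sum rmorphM; apply: lerD.
  rewrite normrM norm_real_complex [`|w _|]ger0_norm ?w0 //.
  by apply: ler_wpM2r; [rewrite ler0c w0 | apply: cB].
apply: le_trans (ler_norm_sum _ _ _) _; apply: ler_sum_nat => n /andP[n1 _].
have wn : 0 <= w n - w n.+1 by rewrite subr_ge0; case/andP: (wd n n1).
rewrite normrM norm_real_complex [`|w _ - _|]ger0_norm // [leRHS]rmorphM.
by apply: ler_wpM2r; [rewrite ler0c | apply: cB].
Qed.

(** The square of the left side is [1 - 2 Re z + |z|^2], to which [1 + t <= expR t] applies. *)
Lemma norm_one_sub_le (R : realType) (z : R[i]) (w : R) : `|z| <= w%:C ->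
  `|1 - z| <= (expR (w ^+ 2 / 2 - complex.Re z))%:C.
Proof.
move=> zlew; have w0 : 0 <= w by rewrite -ler0c (le_trans _ zlew).
have zlew2 : complex.Re z ^+ 2 + complex.Im z ^+ 2 <= w ^+ 2.
  by rewrite -lecR add_Re2_Im2 rmorphXn lerXn2r ?nnegrE ?normr_ge0 ?ler0c.
rewrite normc_def lecR -[leRHS]gtr0_norm ?expR_gt0 // -sqrtr_sqr ler_wsqrtr //.
rewrite -expRM_natl; apply: le_trans (expR_ge1Dx _).
case: z zlew2 {zlew} => a b /=; nra.
Qed.

Definition bounded_character (R : realType) (B : R) (c : nat -> R[i]) :=
  [/\ {morph c : m n / (m * n)%N >-> m * n}, c 1%N = 1, forall n, `|c n| <= 1
    & forall N, `|\sum_(1 <= n < N.+1) c n| <= B%:C].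

Lemma prod_real_le (R : realType) (f : nat -> R[i]) (g : nat -> R) (P : pred nat) m n :
  (forall p, P p -> `|f p| <= (expR (g p))%:C) ->
  `|\prod_(m <= p < n | P p) f p| <= (expR (\sum_(m <= p < n | P p) g p))%:C.
Proof.
move=> fg; rewrite normr_prod expR_sum rmorph_prod.
by apply: ler_prod => p Pp; rewrite normr_ge0 fg.
Qed.

(** Summation by parts bounds the partial sums of [f] by [B] uniformly in [h], while sieving by the
    primes up to [y] leaves little more than the term 1; the condition on [y] controls the tail
    beyond [y]. So the product of the [1 - f p] has norm at least [1 / (2 B)], and its logarithm is,
    up to a constant, at most minus the sum in question. *)
Lemma character_prime_sum_le (R : realType) (B : R) (c : nat -> R[i]) :
  bounded_character B c ->
  exists C : R, forall h y, 0 < h -> (0 < y)%N -> y%:R `^ (- h) / h <= 4^-1 ->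
    \sum_(1 <= p < y.+1 | prime p) complex.Re (c p) * zeta_term h p <= C.
Proof.
case=> cM c1 cle cB; exists (1 + ln (2 * B)) => h y h0 y0 hy.
pose f n := c n * (zeta_term h n)%:C.
have fM : {morph f : m n / (m * n)%N >-> m * n}.
  by move=> m n; rewrite /f cM zeta_termM rmorphM /=; ring.
have fw n : `|f n| <= (zeta_term h n)%:C.
  rewrite normrM norm_real_complex [`|zeta_term _ _|]ger0_norm ?zeta_term_ge0 //.
  by rewrite ler_piMl // ler0c zeta_term_ge0.
have fle n : `|f n| <= 1.
  by apply: le_trans (fw n) _; rewrite -[1](rmorph1 (real_complex R)) lecR zeta_term_le1.
have e4 : 0 < (4^-1)%:C :> R[i] by rewrite ltcR invr_gt0.
have [X0 HX] := euler_sieve fM fle (small_tails_zeta_term h0 fw) y e4.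
pose X := maxn X0 y; have {}HX := HX X (leq_maxl _ _).
have S0B : `|rough_sum f 0 X| <= B%:C.
  rewrite -[B]mulr1 -(zeta_term1 h) /rough_sum.
  under eq_bigl do rewrite coprimen1.
  by apply: norm_sum_decreasing => // n n0; rewrite zeta_term_ge0 zeta_term_homo ?n0 /=.
have S1 : `|rough_sum f y X - 1| <= (4^-1)%:C.
  have f1 : f 1%N = 1 by rewrite /f c1 zeta_term1 mulr1.
  rewrite -f1 -(rough_sum_id f y0) rough_sum_tail ?leq_maxr //.
  apply: le_trans (_ : \sum_(y.+1 <= n < X.+1) (zeta_term h n)%:C <= _); first exact: ler_sum.
  by rewrite -rmorph_sum lecR (le_trans (sum_zeta_term_tail _ h0 y0)).
set P := \prod_(_ <= _ < _ | _) _ in HX.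
(* The sieve error and the tail beyond [y] are at most 1/4 each, which leaves 1 - 1/4 - 1/4. *)
have half : (2^-1)%:C <= B%:C * `|P|.
  apply: le_trans (_ : `|rough_sum f 0 X * P| <= _); last by rewrite normrM ler_wpM2r.
  have := le_trans (ler_normD _ _) (lerD HX S1).
  rewrite -rmorphD addrA subrK distrC => /(le_trans (lerB_dist _ _)); rewrite normr1.
  rewrite lerBlDr addrC -lerBlDr; apply: le_trans.
  by rewrite (_ : 1 = 1%:C) // -rmorphB /= lecR; lra.
have PE : `|P| <= (expR (1 - \sum_(1 <= p < y.+1 | prime p) complex.Re (c p) * zeta_term h p))%:C.
  pose g p := zeta_term h p ^+ 2 / 2 - complex.Re (c p) * zeta_term h p.
  apply: le_trans (prod_real_le _ _ (g := g) _) _.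
    move=> p _; rewrite /g; have -> : complex.Re (c p) * zeta_term h p = complex.Re (f p).
      by rewrite /f; case: (c p) => a b /=; rewrite mulr0 subr0.
    exact: norm_one_sub_le.
  rewrite lecR ler_expR /g sumrB lerD2r -mulr_suml ler_pdivrMr // mul1r.
  exact: sum_zeta_term_sq_le.
set S := \sum_(_ <= _ < _ | _) _ in PE *.
have B0 : 0 <= B by rewrite -ler0c; apply: le_trans (cB 0%N).
have := ler_wpM2l (_ : 0 <= B%:C) PE; rewrite ler0c => /(_ B0) /(le_trans half).
rewrite -rmorphM lecR => H.
have B1 : 0 < B.
  rewrite lt_neqAle B0 andbT; apply/eqP => E; move: H; rewrite -E mul0r; lra.
have : expR 0 <= expR (1 + ln (2 * B) - S).
  rewrite expR0 addrAC expRD lnK ?posrE ?mulr_gt0 //; nra.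
by rewrite ler_expR subr_ge0.
Qed.

Local Close Scope complex_scope.

Lemma small_tails_zeta_term_real (R : realType) (h : R) : 0 < h -> small_tails (zeta_term h).
Proof.
move=> h0 e e0; have [X0 HX] := powRN_small h0 (mulr_gt0 e0 h0).
exists X0 => X Y /HX[X1 XY]; under eq_bigr do rewrite ger0_norm ?zeta_term_ge0 //.
by rewrite (le_trans (sum_zeta_term_tail _ h0 X1)) // ler_pdivrMr.
Qed.

Lemma norm_zeta_term_le1 (R : realType) (h : R) n : 0 < h -> `|zeta_term h n| <= 1.
Proof. by move=> h0; rewrite ger0_norm ?zeta_term_ge0 ?zeta_term_le1. Qed.

(** The sieved sum contains the term 1, so the full sum times the product [P] is at least 1/2,
    whereas [P <= expR (- S)]. *)
Lemma prime_zeta_term_sum_le (R : realType) (h : R) y : 0 < h ->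
  \sum_(1 <= p < y.+1 | prime p) zeta_term h p <= ln (2 * (1 + h^-1)).
Proof.
move=> h0; have e2 : 0 < 2^-1 :> R by rewrite invr_gt0.
have [X0 HX] := euler_sieve (zeta_termM h) (fun n => norm_zeta_term_le1 n h0)
  (small_tails_zeta_term_real h0) y e2.
pose X := maxn X0 1; have := HX X (leq_maxl _ _).
set P := \prod_(_ <= _ < _ | _) _; set S := \sum_(_ <= _ < _ | _) _ => {HX}.
have S0 : rough_sum (zeta_term h) 0 X <= 1 + h^-1.
  rewrite /rough_sum; under eq_bigl do rewrite coprimen1.
  exact: sum_zeta_term_le.
have Sy : 1 <= rough_sum (zeta_term h) y X.
  rewrite -(zeta_term1 h) /rough_sum big_ltn_cond ?ltnS ?leq_maxr // coprime1n lerDl.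
  by apply: sumr_ge0 => n _; apply: zeta_term_ge0.
have P0 : 0 <= P by apply: prodr_ge0 => p _; rewrite subr_ge0 zeta_term_le1.
have PE : P <= expR (- S).
  rewrite -sumrN expR_sum; apply: ler_prod => p _; rewrite subr_ge0 zeta_term_le1 //=.
  exact: le_trans (expR_ge1Dx _).
rewrite ler_distl => /andP[H _].
have h1 : 0 < 1 + h^-1 by rewrite addr_gt0 ?invr_gt0.
have K : 2^-1 <= (1 + h^-1) * expR (- S).
  apply: le_trans (_ : rough_sum (zeta_term h) 0 X * P <= _); first lra.
  by apply: ler_pM => //; apply: sumr_ge0 => n _; apply: zeta_term_ge0.
rewrite -[S]expRK ler_ln ?posrE ?expR_gt0 ?mulr_gt0 // -[expR S]invrK -expRN.
rewrite invf_ple ?posrE ?expR_gt0 ?mulr_gt0 // invfM.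
by rewrite ler_pdivrMr // mulrC.
Qed.

(** In the reverse direction, the full sum is at least [1 / (2 h)] and the sieved one at most 1 +
    1/4, so the product is at most [3 h]; its factors are bounded below by
    [1 - w >= expR (- (w + 2 w^2))] for [w <= 1/2]. *)
Lemma prime_zeta_term_sum_ge (R : realType) (h : R) y : 0 < h -> (0 < y)%N ->
  y%:R `^ (- h) / h <= 4^-1 ->
  - ln h - 6 <= \sum_(1 <= p < y.+1 | prime p) zeta_term h p.
Proof.
move=> h0 y0 hy; have e4 : 0 < 4^-1 :> R by rewrite invr_gt0.
have e2 : 0 < 2^-1 :> R by rewrite invr_gt0.
have [X0 HX] := euler_sieve (zeta_termM h) (fun n => norm_zeta_term_le1 n h0)
  (small_tails_zeta_term_real h0) y e4.
have [X1 HX1] := powRN_small h0 e2.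
pose X := maxn X0 (maxn X1 y); have := HX X (leq_maxl _ _).
set P := \prod_(_ <= _ < _ | _) _; set S := \sum_(_ <= _ < _ | _) _ => {HX}.
have S0 : (2 * h)^-1 <= rough_sum (zeta_term h) 0 X.
  rewrite /rough_sum; under eq_bigl do rewrite coprimen1.
  apply: le_trans (sum_zeta_term_ge X h0); rewrite invfM ler_wpM2r ?invr_ge0 ?(ltW h0) //.
  have [|_ ?] := HX1 X.+1; last lra.
  by rewrite leqW // leq_max leq_max leqnn orbT.
have Sy : rough_sum (zeta_term h) y X <= 1 + 4^-1.
  have := @rough_sum_tail _ (zeta_term h) y X y 4^-1 _ _; rewrite rough_sum_id // zeta_term1.
  rewrite leq_max leq_maxr orbT => /(_ isT); under eq_bigr do rewrite ger0_norm ?zeta_term_ge0 //.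
  by move=> /(_ (le_trans (sum_zeta_term_tail _ h0 y0) hy)); rewrite ler_distl => /andP[_].
have P0 : 0 <= P by apply: prodr_ge0 => p _; rewrite subr_ge0 zeta_term_le1.
(* The constant 4 is twice the bound 2 for the sum of the squares. *)
have PE : expR (- S - 4) <= P.
  apply: le_trans (_ : expR (\sum_(1 <= p < y.+1 | prime p)
      - (zeta_term h p + 2 * zeta_term h p ^+ 2)) <= _).
    rewrite ler_expR sumrN big_split /= -/S -opprD lerN2 lerD2l -mulr_sumr.
    have -> : 4 = 2 * 2 :> R by lra.
    by rewrite ler_wpM2l // sum_zeta_term_sq_le.
  rewrite expR_sum; apply: ler_prod => p pp; rewrite expR_ge0 /= expRN.
  have w0 := zeta_term_ge0 h p.
  have w2 : zeta_term h p <= 2^-1.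
    apply: le_trans (zeta_term_homo h0 (_ : (0 < 2 <= p)%N)) _; first by rewrite prime_gt1.
    rewrite /zeta_term -[X in _ <= X]powR_inv1 //; apply: ler_powR; first by rewrite ler1n.
    lra.
  have e0 := expR_gt0 (zeta_term h p + 2 * zeta_term h p ^+ 2).
  have e1 := expR_ge1Dx (zeta_term h p + 2 * zeta_term h p ^+ 2).
  rewrite -(ler_pM2r e0) mulVf ?gt_eqF //.
  (* With [w = zeta_term h p] the product is [1 + w^2 (1 - 2 w)]. *)
  have : (1 - zeta_term h p) * (1 + (zeta_term h p + 2 * zeta_term h p ^+ 2)) >= 1 by nra.
  by move=> K; apply: le_trans K _; rewrite ler_wpM2l // subr_ge0; lra.
rewrite ler_distl => /andP[_ H].
have h2 : 0 < (2 * h)^-1 by rewrite invr_gt0 mulr_gt0.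
have K : (2 * h)^-1 * expR (- S - 4) <= 3 / 2.
  apply: le_trans (_ : rough_sum (zeta_term h) 0 X * P <= _); last lra.
  by apply: ler_pM => //; rewrite ?expR_ge0 ?(ltW h2).
have {}K : expR (- S - 4) <= expR (2 + ln h).
  rewrite [expR (2 + _)]expRD lnK ?posrE //; have := expR_ge1Dx (2 : R).
  have : (2 * h) * ((2 * h)^-1 * expR (- S - 4)) = expR (- S - 4).
    by rewrite mulrA mulfV ?mul1r // gt_eqF // mulr_gt0.
  nra.
by move: K; rewrite ler_expR; lra.
Qed.

(** * Dirichlet characters *)

Lemma primitive_root_exists (C : numClosedFieldType) (n : nat) :
  (0 < n)%N -> exists z : C, n.-primitive_root z.
Proof.
move=> n0; have [rs rsE] := closed_field_poly_normal ('X^n - 1%:P : {poly C}).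
move: rsE; rewrite (monicP (monicXnsubC 1 n0)) scale1r => rsE.
have sz : size rs = n.
  by apply: succn_inj; rewrite -(size_prod_XsubC rs idfun) -rsE size_XnsubC.
have urs : all n.-unity_root rs.
  by apply/allP => z; rewrite -root_prod_XsubC -rsE.
have uniq_rs : uniq rs.
  by rewrite -separable_prod_XsubC -rsE polyC1 separable_Xn_sub_1 // pnatr_eq0 -lt0n.
by have /hasP[z _ ?] := has_prim_root n0 urs uniq_rs (eq_leq (esym sz)); exists z.
Qed.

Lemma Fp_primitive_root_exists (r : nat) : prime r ->
  exists g : 'F_r, (r.-1).-primitive_root g.
Proof.
move=> pr; have r1 : (0 < r.-1)%N by rewrite -ltnS prednK ?prime_gt1 ?prime_gt0.
have ur : all (r.-1).-unity_root (enum (predC1 (0 : 'F_r))).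
  apply/allP => x; rewrite mem_enum inE => x0; apply/unity_rootP.
  apply: (mulfI x0); rewrite -exprS mulr1 prednK ?prime_gt0 //.
  by have := expf_card x; rewrite card_Fp.
have sz : (r.-1 <= size (enum (predC1 (0%R : 'F_r))))%N.
  by rewrite -cardE cardC1 card_Fp.
have /hasP[g _ gP] := has_prim_root r1 ur (enum_uniq _) sz.
by exists g.
Qed.

Definition periodic_character (C : numDomainType) (d : nat) (c : nat -> C) :=
  [/\ {morph c : m n / (m * n)%N >-> m * n}, c 1%N = 1,
      forall n, `|c n| <= 1 & forall n, c (n %% d)%N = c n].

(** For a generator [g] of the unit group of ['F_r] and a primitive root of unity [z] of order
    [r.-1], the character [c j] sends [g ^+ i] to [z ^+ (i * j)] and 0 to 0. The last two clauses
    are the orthogonality relations. *)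
Lemma prime_characters (C : numClosedFieldType) (r : nat) : prime r ->
  exists c : nat -> nat -> C,
  [/\ forall j, periodic_character r (c j),
      forall n, c 0%N n = (~~ (r %| n)%N)%:R,
      forall j, (0 < j < r.-1)%N -> \sum_(0 <= n < r) c j n = 0
    & forall n, \sum_(0 <= j < r.-1) c j n = (r.-1)%:R *+ (n == 1 %[mod r])].
Proof.
move=> pr; have r0 := prime_gt0 pr.
have r1 : (0 < r.-1)%N by rewrite -ltnS prednK ?prime_gt1.
have [g gP] := Fp_primitive_root_exists pr.
have [z zP] := primitive_root_exists C r1.
(* The discrete logarithm to base [g]; the default 0 is taken only at [x = 0], which [e] treats
   separately. *)
pose dl (x : 'F_r) : nat := odflt 0%N (omap val [pick i : 'I_r.-1 | g ^+ i == x]).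
have dlP x : x != 0 -> g ^+ dl x = x.
  move=> x0; rewrite /dl; case: pickP => [i /eqP //|no].
  have xr : x ^+ r.-1 = 1.
    apply: (mulfI x0); rewrite -exprS mulr1 prednK //.
    by have := expf_card x; rewrite card_Fp.
  by have [i xE] := prim_rootP gP xr; have := no i; rewrite -xE eqxx.
have zg i k : g ^+ i = g ^+ k -> z ^+ i = z ^+ k.
  by move/eqP; rewrite (eq_prim_root_expr gP) => ?; apply/eqP; rewrite (eq_prim_root_expr zP).
pose e j (x : 'F_r) : C := if x == 0 then 0 else (z ^+ dl x) ^+ j.
have eM j x y : e j (x * y) = e j x * e j y.
  rewrite /e mulf_eq0; have [->|x0] := eqVneq x 0; first by rewrite /= mul0r.
  have [->|y0] := eqVneq y 0; first by rewrite /= mulr0.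
  rewrite /= -exprMn -exprD; congr (_ ^+ j); apply: zg.
  by rewrite exprD !dlP ?mulf_neq0.
have n0E n : (n%:R == 0 :> 'F_r) = (r %| n)%N.
  by rewrite -(dvdn_pcharf (pchar_Fp pr)).
have nz : `|z| = 1.
  by apply/eqP; rewrite -(pexpr_eq1 r1) // -normrX (prim_expr_order zP) normr1.
have e1 j : e j 1 = 1.
  have zdl : z ^+ dl 1 = 1.
    by rewrite (zg _ 0%N) ?expr0 // dlP ?oner_neq0.
  by rewrite /e oner_eq0 zdl expr1n.
exists (fun j n => e j n%:R); split.
- move=> j; split.
  + by move=> m n; rewrite natrM eM.
  + exact: e1.
  + by move=> n; rewrite /e; case: ifP; rewrite ?normr0 // !normrX nz !expr1n.
  + by move=> n; rewrite (Fp_nat_mod pr).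
- by move=> n; rewrite /e n0E expr0; case: ifP.
- move=> j /andP[j0 jr].
  have -> : \sum_(0 <= n < r) e j n%:R = \sum_(x : 'F_r) e j x.
    have -> (F : nat -> C) : \sum_(0 <= n < r) F n = \sum_(x : 'F_r) F x.
      by rewrite -[in LHS](Fp_cast pr) big_mkord.
    by apply: eq_bigr => x _; rewrite natr_Zp.
  have g0 : g != 0 by rewrite (prim_root_eq0 gP) -lt0n.
  (* Multiplication by [g] permutes the summands, and [e j g = z ^+ j] differs from 1. *)
  have : e j g * \sum_x e j x = \sum_x e j x.
    rewrite mulr_sumr [RHS](reindex_inj (mulfI g0)) /=.
    by apply: eq_bigr => x _; rewrite eM.
  move/eqP; rewrite -subr_eq0 -{2}[\sum_x _]mul1r -mulrBl mulf_eq0 => /orP[|/eqP //].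
  rewrite subr_eq0 /e (negPf g0) (zg _ 1%N) ?expr1 ?dlP // -(prim_order_dvd zP).
  by rewrite gtnNdvd.
- move=> n; rewrite big_mkord.
  have [/eqP n1|n1] := boolP (n == 1 %[mod r]).
    have -> : n%:R = 1 :> 'F_r by rewrite -(Fp_nat_mod pr n) n1 (Fp_nat_mod pr).
    by under eq_bigr do rewrite e1; rewrite sumr_const card_ord.
  rewrite mulr0n /e; have [n0|n0] := eqVneq n%:R (0 : 'F_r); first by rewrite big1.
  set u := z ^+ _; have u1 : u != 1.
    rewrite -[1]/(z ^+ 0) (eq_prim_root_expr zP) -(eq_prim_root_expr gP) dlP // expr0.
    apply: contraNneq n1 => n1; have := val_Fp_nat pr n.
    by rewrite n1 => <-; have := val_Fp_nat pr 1 => ->.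
  apply/eqP; have : (u - 1) * \sum_(i < r.-1) u ^+ i = 0.
    by rewrite -subrX1 /u exprAC (prim_expr_order zP) expr1n subrr.
  by move/eqP; rewrite mulf_eq0 subr_eq0 (negPf u1).
Qed.

Local Open Scope complex_scope.

Lemma sum_nat_mul (V : nmodType) (F : nat -> V) (k d : nat) :
  \sum_(0 <= n < k * d) F n = \sum_(0 <= j < k) \sum_(0 <= i < d) F (j * d + i)%N.
Proof.
elim: k => [|k IHk]; first by rewrite !big_geq.
rewrite mulSnr big_nat_recr //= -IHk (big_cat_nat (n := (k * d)%N)) ?leq_addr //=.
congr (_ + _); rewrite -{1}[(k * d)%N]add0n big_addn addnC addnK.
by apply: eq_bigr => i _; rewrite addnC.
Qed.

Lemma sum_residues (V : nmodType) (F : nat -> V) (d r i : nat) : coprime d r ->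
  (forall n, F (n %% r)%N = F n) ->
  \sum_(0 <= k < r) F (k * d + i)%N = \sum_(0 <= k < r) F k.
Proof.
case: r => [|r] dr Fr; first by rewrite !big_geq.
rewrite !big_mkord; pose s (k : 'I_r.+1) : 'I_r.+1 := inord ((k * d + i) %% r.+1).
have sE k : s k = ((k * d + i) %% r.+1)%N :> nat by rewrite inordK // ltn_pmod.
have s_inj : injective s.
  move=> k l /(congr1 val) /=; rewrite !sE => /eqP.
  rewrite eqn_modDr => /eqP kl; apply: val_inj => /=.
  wlog lekl : k l kl / (k <= l)%N.
    by move=> W; case/orP: (leq_total k l) => [/W->|/W->].
  apply/eqP; rewrite eqn_leq lekl /= -subn_eq0; apply/eqP.
  move/eqP: kl; rewrite eq_sym eqn_mod_dvd ?leq_mul2r ?lekl ?orbT // -mulnBl.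
  rewrite Gauss_dvdl 1?coprime_sym // => /dvdnP[[|q] E]; first by rewrite E.
  by move: E (ltn_ord l); rewrite mulSn; lia.
by rewrite [RHS](reindex_inj s_inj) /=; apply: eq_bigr => k _; rewrite sE Fr.
Qed.

(** Write [n = k * d + i]: then [c n] depends on [i] only, and for fixed [i] the numbers [k * d + i]
    run through all residues modulo [r]. *)
Lemma sum_coprime_product (C : comNzRingType) (c e : nat -> C) (d r : nat) : coprime d r ->
  (forall n, c (n %% d)%N = c n) -> (forall n, e (n %% r)%N = e n) ->
  \sum_(0 <= n < r * d) c n * e n = (\sum_(0 <= n < d) c n) * (\sum_(0 <= n < r) e n).
Proof.
move=> dr cd er; rewrite sum_nat_mul exchange_big /= mulr_suml.
apply: eq_bigr => i _; rewrite -(sum_residues i dr er) mulr_sumr.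
by apply: eq_bigr => k _; rewrite -(cd (k * d + i)%N) modnMDl cd.
Qed.

(** Complete periods cancel, and the fewer than [d] remaining terms have norm at most 1. *)
Lemma bounded_nontrivial_character (R : realType) (d : nat) (c : nat -> R[i]) : (0 < d)%N ->
  periodic_character d c -> \sum_(0 <= n < d) c n = 0 -> bounded_character d%:R c.
Proof.
move=> d0 [cM c1 cle cd] c0; split=> // N.
(* If [c 0] were nonzero, [c 0 * c n = c 0] would force [c] to be constantly 1, with sum [d] over a
   period. *)
have z0 : c 0%N = 0.
  apply/eqP; apply: contraT => nz; move: c0 => /eqP.
  have cE n : c n = 1 by apply: (mulfI nz); rewrite -cM mul0n mulr1.
  by under eq_bigr do rewrite cE; rewrite sumr_const_nat subn0 pnatr_eq0 eqn0Ngt d0.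
have -> : \sum_(1 <= n < N.+1) c n = \sum_(0 <= n < N.+1) c n.
  by rewrite [RHS]big_ltn // z0 add0r.
rewrite [in leLHS](divn_eq N.+1 d) (big_cat_nat (n := (N.+1 %/ d * d)%N)) ?leq_addr //=.
rewrite sum_nat_mul big1 => [|j _]; last first.
  by under eq_bigr => i _ do rewrite -cd modnMDl cd; rewrite c0.
rewrite add0r; apply: le_trans (ler_norm_sum _ _ _) _.
apply: le_trans (_ : _ <= \sum_(N.+1 %/ d * d <= i < N.+1 %/ d * d + N.+1 %% d) 1) _.
  by apply: ler_sum => n _.
by rewrite sumr_const_nat addKn rmorph_nat ler_nat ltnW // ltn_pmod //.
Qed.

(* The functions c i are the Dirichlet characters modulo d = \prod rs, i0 being the
   principal one; b i are the Fourier coefficients of a multiple of the indicator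
   function of the set of invertible residues that are not 1 modulo any r in rs. *)
Definition character_family (R : realType) (rs : seq nat) (I : finType) (i0 : I)
    (b : I -> R) (c : I -> nat -> R[i]) :=
  [/\ forall i, periodic_character (\prod_(r <- rs) r)%N (c i),
      (forall n, c i0 n = (coprime n (\prod_(r <- rs) r)%N)%:R) /\ b i0 = 1,
      forall i, i != i0 -> -1 <= b i <= 2^-1 /\
        \sum_(0 <= n < (\prod_(r <- rs) r)%N) c i n = 0,
      forall n, 0 <= \sum_i c i n
    & forall n, 0 <= \sum_i (b i)%:C * c i n
        <= (2 ^+ size rs *+ all (fun r => n != 1 %[mod r]) rs)%:C].

(* A nonprincipal character modulo r has the coefficient -1/(r - 2).  For r = 3 this is -1,
   which would spoil b i <= 1/2 in products with negative coefficients, so 3 comes first. *)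
Lemma character_family_cons (R : realType) (rs : seq nat) (I : finType) (i0 : I)
    (b : I -> R) (c : I -> nat -> R[i]) (r : nat) :
  prime r -> (2 < r)%N -> coprime (\prod_(s <- rs) s)%N r -> (4 < r)%N || (#|I| == 1)%N ->
  character_family rs i0 b c ->
  exists (I' : finType) (i0' : I') (b' : I' -> R) (c' : I' -> nat -> R[i]),
    character_family (r :: rs) i0' b' c'.
Proof.
move=> pr r3 dr large [cP [c0 b0] ci cge0 bc].
have [e [eP e0 eS eT]] := prime_characters R[i] pr.
case: r pr r3 dr large e0 eS eT eP => [|[|[|m]]] // pr r3 dr large e0 eS eT eP.
set r := m.+3 in pr r3 dr large e0 eS eT eP *; set d := (\prod_(s <- rs) s)%N in cP c0 ci dr.
(* Here [r = m + 3], so [t = 1 / (r - 2)]. *)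
pose t : R := m.+1%:R^-1.
have m0 : 0 < t by rewrite /t invr_gt0 ltr0n.
have m1 : t <= 1 by rewrite /t -[leRHS]invr1 lef_pV2 ?posrE ?ltr0n // ler1n.
have tE : t * m.+1%:R = 1 by rewrite mulVf // pnatr_eq0.
pose f (j : 'I_r.-1) : R := if j == ord0 then 1 else - t.
exists (I * 'I_r.-1)%type, (i0, ord0), (fun x => b x.1 * f x.2),
  (fun x : I * 'I_r.-1 => fun n => c x.1 n * e x.2 n).
have dist (g : I -> R[i]) (h : 'I_r.-1 -> R[i]) :
    \sum_(x : I * 'I_r.-1) (g x.1 * h x.2) = (\sum_i g i) * (\sum_j h j).
  by rewrite big_distrlr /= pair_big.
split.
- move=> [i j] /=; have [cM c1 cle cd] := cP i; have [eM e1 ele er] := eP j.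
  rewrite big_cons -/d; split.
  + by move=> k l; rewrite cM eM mulrACA.
  + by rewrite c1 e1 mulr1.
  + by move=> n; rewrite normrM mulr_ile1.
  + move=> n; rewrite -(cd (n %% _)%N) -(er (n %% _)%N) modn_dvdm ?dvdn_mull //.
    by rewrite modn_dvdm ?dvdn_mulr // cd er.
- split=> [n|]; last by rewrite /= b0 mulr1.
  rewrite big_cons -/d c0 e0 -natrM mulnb coprimeMr andbC; congr (_ && _)%:R.
  by rewrite coprime_sym prime_coprime.
- move=> [i j] /= ij; have [_ _ _ cd] := cP i; have [_ _ _ er] := eP j.
  rewrite big_cons -/d sum_coprime_product //; split; last first.
    have [ii|ii] := eqVneq i i0; last by have [_ ->] := ci i ii; rewrite mul0r.
    rewrite eS ?mulr0 // ltn_ord andbT lt0n; apply: contraNneq ij => j0.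
    by rewrite xpair_eqE ii eqxx; apply/eqP/val_inj.
  rewrite /f; have [ii|ii] := eqVneq i i0.
    have /negPf -> : j != ord0 by apply: contraNneq ij => ->; rewrite ii.
    rewrite ii b0 mul1r; apply/andP; split; lra.
  have [/andP[bi1 bi2] _] := ci i ii; case: ifP => _; first by rewrite mulr1 bi1 bi2.
  (* The product [b i * (- t)] can be as large as [t] when [b i = -1], so [t <= 1/2] is required; a
     one-element [I] has no index other than [i0]. *)
  have m3 : t <= 2^-1 :> R.
    case/orP: large => [m2|I1]; last first.
      by have := fintype1 (eqP I1) => -[x xP]; rewrite (xP i) (xP i0) eqxx in ii.
    rewrite /t lef_pV2 ?posrE ?ltr0n // ler_nat; lia.
  apply/andP; split; nra.
- move=> n; rewrite (dist (c^~ n) (fun j : 'I_r.-1 => e j n)) mulr_ge0 //.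
  by rewrite -(big_mkord xpredT (fun j => e j n)) eT mulrn_wge0.
move=> n.
have -> : \sum_(i : I * 'I_r.-1) (b i.1 * f i.2)%:C * (c i.1 n * e i.2 n) =
    (\sum_i (b i)%:C * c i n) * (\sum_j (f j)%:C * e j n).
  rewrite -(dist (fun i => (b i)%:C * c i n) (fun j : 'I_r.-1 => (f j)%:C * e j n)).
  by apply: eq_bigr => x _; rewrite rmorphM mulrACA.
(* The coefficients [f] come from [1 + t] times the principal character minus [t] times the sum of
   all characters. At [n = 1] modulo [r] this is [1 + t - t (r - 1) = 0]. *)
have fE : \sum_j (f j)%:C * e j n =
    ((1 + t) *+ (~~ (r %| n) && (n != 1 %[mod r]))%N)%:C.
  have -> : \sum_j (f j)%:C * e j n =
      (1 + t)%:C * e 0%N n - (t)%:C * \sum_(0 <= j < r.-1) e j n.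
    rewrite big_mkord mulr_sumr /= big_ord_recl [in RHS]big_ord_recl /= mul1r opprD addrA.
    rewrite rmorphD rmorph1 mulrDl mul1r addrK; congr (_ + _).
    by rewrite -sumrN; apply: eq_bigr => j _; rewrite /f /= rmorphN mulNr.
  rewrite e0 eT; have [/eqP n1|n1] := boolP (n == 1 %[mod r]).
    have -> : (r %| n)%N = false by rewrite /dvdn n1.
    transitivity ((1 + t) * 1 - t * r.-1%:R)%:C.
      by rewrite rmorphB !rmorphM rmorph_nat.
    by congr (_%:C); rewrite /r /= -[m.+2]addn1 natrD mulrDr tE; ring.
  rewrite mulr0 subr0 andbT; case: (r %| n)%N; first by rewrite mulr0.
  by rewrite mulr1.
have := bc n; rewrite fE /=.
have [n1|n1] /= := boolP (n != 1 %[mod r]); last by rewrite andbF mulr0 lexx.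
rewrite andbT => /andP[S0 S1].
have t0 : 0 <= ((1 + t) *+ ~~ (r %| n)%N)%:C :> R[i].
  by rewrite lecR mulrn_wge0 // addr_ge0 // ltW.
rewrite mulr_ge0 //= exprS -mulrnAr rmorphM mulrC ler_pM //.
by rewrite lecR; case: (r %| n)%N => /=; lra.
Qed.

Lemma coprime_prod_primes (rs : seq nat) (r : nat) :
  prime r -> all prime rs -> r \notin rs -> coprime (\prod_(s <- rs) s)%N r.
Proof.
move=> pr; elim: rs => [|s rs IHrs] /=; first by rewrite big_nil coprime1n.
move=> /andP[ps prs]; rewrite inE negb_or => /andP[rs' /(IHrs prs)].
by rewrite big_cons coprimeMl => ->; rewrite prime_coprime // dvdn_prime2 // eq_sym rs'.
Qed.

(** The family modulo 3 is built from the trivial one modulo 1; each larger prime is then put in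
    front of it. *)
Lemma character_family_exists (R : realType) (rs : seq nat) :
  uniq rs -> all (fun r => prime r && (4 < r)%N) rs ->
  exists (I : finType) (i0 : I) (b : I -> R) (c : I -> nat -> R[i]),
    character_family (rcons rs 3) i0 b c.
Proof.
elim: rs => [_ _|r rs IHrs /= /andP[rrs urs] /andP[/andP[pr r4] prs]].
  apply: (@character_family_cons R [::] unit tt (fun=> 1) (fun _ _ => 1) 3) => //.
  - by rewrite big_nil.
  - by rewrite card_unit.
  rewrite /character_family !big_nil; split=> //.
  - by move=> i; split=> // [m n|n]; rewrite ?mulr1 ?normr1.
  - by split=> // n; rewrite coprimen1.
  - by move=> n; rewrite big_const card_unit /= addr0 ler01.
  - by move=> n; rewrite big_const card_unit /= addr0 mulr1 ler01 lexx.
have [I [i0 [b [c bc]]]] := IHrs urs prs.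
apply: (@character_family_cons R (rcons rs 3) I i0 b c r) => //; first lia.
  apply: coprime_prod_primes => //; last by rewrite mem_rcons inE negb_or rrs andbT; lia.
  by rewrite all_rcons /=; apply: sub_all prs => s /andP[].
by rewrite r4.
Qed.

(** * Primes that avoid the residue 1 *)

(** At most [d] primes divide [d], and each has weight at most 1. *)
Lemma sum_prime_coprime_ge (R : realType) (w : nat -> R) (d y : nat) :
  (0 < d)%N -> (forall n, 0 <= w n <= 1) ->
  \sum_(1 <= p < y.+1 | prime p) w p - d%:R <=
  \sum_(1 <= p < y.+1 | prime p) (coprime p d)%:R * w p.
Proof.
move=> d0 w01; have w0 n : 0 <= w n by case/andP: (w01 n).
rewrite lerBlDr -lerBlDl -sumrB.
apply: le_trans (_ : \sum_(1 <= p < y.+1 | p \in index_iota 1 d.+1) 1 <= _); last first.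
  rewrite -big_filter big_const_seq count_predT iter_addr_0; apply: le_trans (_ : (size (index_iota 1 d.+1))%:R <= _).
    rewrite ler_nat; apply: uniq_leq_size; first exact/filter_uniq/iota_uniq.
    by move=> p; rewrite mem_filter => /andP[].
  by rewrite size_iota subn1.
rewrite big_mkcond [leRHS]big_mkcond; apply: ler_sum => p _.
case: ifP => [pp|_]; last by case: ifP.
rewrite -[X in X - _]mul1r -mulrBl prime_coprime //.
have [pd|_] /= := boolP (p %| d)%N; last by rewrite subrr mul0r; case: ifP.
by rewrite mem_index_iota prime_gt0 //= ltnS dvdn_leq // subr0 mul1r; case/andP: (w01 p).
Qed.

Definition avoids_one (rs : seq nat) (p : nat) := all (fun r => p != 1 %[mod r]) rs.

(** The sum of [(b i - 2^-1) * S i h y] over all characters is estimated twice. Below: the principal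
    term is at least [- ln h / 2] up to a constant, and the others have nonpositive coefficients and
    sums bounded above. Above, prime by prime: [\sum_i c i p >= 0] allows the part with [2^-1] to be
    dropped, which leaves at most [K] at avoiding primes and at most 0 elsewhere. *)
Lemma avoiding_primes_zeta_term_sum_ge (R : realType) (rs : seq nat) :
  uniq rs -> all (fun r => prime r && (4 < r)%N) rs ->
  exists e C : R, 0 < e /\ forall h y, 0 < h -> (0 < y)%N -> y%:R `^ (- h) / h <= 4^-1 ->
    e * (- ln h) - C <= \sum_(1 <= p < y.+1 | prime p && avoids_one (rcons rs 3) p) zeta_term h p.
Proof.
move=> urs prs; have [I [i0 [b [c [cP [c0 b0] ci cge0 bc]]]]] := character_family_exists R urs prs.
set d := (\prod_(r <- rcons rs 3) r)%N in cP c0 ci.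
set K : R := 2 ^+ size (rcons rs 3) in bc.
have K0 : 0 < K by rewrite exprn_gt0.
have d0 : (0 < d)%N.
  have : all prime (rcons rs 3) by rewrite all_rcons; apply: sub_all prs => s /andP[].
  rewrite /d; elim: (rcons rs 3) => [|s l IHl] /=; first by rewrite big_nil.
  by move=> /andP[ps /IHl l0]; rewrite big_cons muln_gt0 prime_gt0.
pose S (i : I) h y := \sum_(1 <= p < y.+1 | prime p) complex.Re (c i p) * zeta_term h p.
have [D SD] : exists D : I -> R, forall i, i != i0 -> forall h y, 0 < h -> (0 < y)%N ->
    y%:R `^ (- h) / h <= 4^-1 -> S i h y <= D i.
  have H (i : I) : exists D : R, i != i0 -> forall h y, 0 < h -> (0 < y)%N ->
      y%:R `^ (- h) / h <= 4^-1 -> S i h y <= D.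
    have [->|ii] := eqVneq i i0; first by exists 0.
    have [_ ci0] := ci i ii.
    have [C HC] := character_prime_sum_le (bounded_nontrivial_character d0 (cP i) ci0).
    by exists C.
  by have [D HD] := boolp.choice H; exists D.
exists ((2 * K)^-1), (K^-1 * (2^-1 * (6 + d%:R) + \sum_(i | i != i0) 3 / 2 * `|D i|)).
split=> [|h y h0 y0 hy]; first by rewrite invr_gt0 mulr_gt0.
have low : 2^-1 * (- ln h - 6 - d%:R) - \sum_(i | i != i0) 3 / 2 * `|D i| <=
    \sum_i (b i - 2^-1) * S i h y.
  rewrite [leRHS](bigD1 i0) //= b0; apply: lerD.
    have -> : 1 - 2^-1 = 2^-1 :> R by lra.
    rewrite ler_pM2l ?invr_gt0 //.
    have := sum_prime_coprime_ge (w := zeta_term h) y d0; move=> /=.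
    have -> : S i0 h y = \sum_(1 <= p < y.+1 | prime p) (coprime p d)%:R * zeta_term h p.
      by apply: eq_bigr => p _; rewrite c0 -[_%:R in LHS](rmorph_nat (real_complex R)).
    move=> H; apply: le_trans (H _); last by move=> n; rewrite zeta_term_ge0 zeta_term_le1.
    by rewrite lerD2r prime_zeta_term_sum_ge.
  (* The coefficient [b i - 2^-1] lies between -3/2 and 0. *)
  rewrite -sumrN; apply: ler_sum => i ii; have [/andP[b1 b2] _] := ci i ii.
  have := SD i ii h y h0 y0 hy; have := ler_norm (D i); have := normr_ge0 (D i).
  set u := `|D i|; nra.
have up : \sum_i (b i - 2^-1) * S i h y <=
    \sum_(1 <= p < y.+1 | prime p && avoids_one (rcons rs 3) p) K * zeta_term h p.
  under eq_bigr do rewrite mulr_sumr; rewrite exchange_big /= big_mkcondr /=.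
  apply: ler_sum => p _; under eq_bigr do rewrite mulrA; rewrite -mulr_suml.
  rewrite -mulrb -mulrnAl ler_wpM2r ?zeta_term_ge0 //.
  have := bc p; have := cge0 p.
  rewrite !lecE /= => /andP[_ g0] /andP[_ /andP[_]].
  rewrite !raddf_sum /= in g0 *.
  apply: le_trans; rewrite -subr_ge0 -sumrB.
  have -> : \sum_i (complex.Re ((b i)%:C * c i p) - (b i - 2^-1) * complex.Re (c i p)) =
      2^-1 * \sum_i complex.Re (c i p).
    by rewrite mulr_sumr; apply: eq_bigr => i _; case: (c i p) => u v /=; ring.
  by rewrite mulr_ge0 ?invr_ge0.
rewrite -mulr_sumr in up.
have := le_trans low up; rewrite -ler_pdivrMl //; apply: le_trans.
by rewrite invfM; lra.
Qed.

Local Close Scope complex_scope.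

(** * Integers without an isolated prime *)

(** For [h = 1 / ln y] and [p <= y] the factor [p^h] is at most [expR 1]. *)
Lemma sum_prime_inv_le (R : realType) (y : nat) : (1 < y)%N ->
  \sum_(1 <= p < y.+1 | prime p) p%:R^-1 <= expR 1 * ln (2 * (1 + ln y%:R)) :> R.
Proof.
move=> y1; have ly : 0 < ln y%:R :> R by rewrite ln_gt0 // ltr1n.
have h0 : 0 < (ln y%:R)^-1 :> R by rewrite invr_gt0.
have := prime_zeta_term_sum_le y h0; rewrite invrK => H.
apply: le_trans (_ : _ <= expR 1 * _) (ler_wpM2l (expR_ge0 1) H).
rewrite mulr_sumr big_nat_cond [leRHS]big_nat_cond; apply: ler_sum => p /andP[/andP[p1 py] pp].
have pR : 0 < p%:R :> R by rewrite ltr0n.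
have p0 : p%:R != 0 :> R by rewrite gt_eqF.
rewrite /zeta_term /powR (negPf p0) -expRD -{1}[p%:R](lnK pR) -expRN ler_expR.
have : ln p%:R / ln y%:R <= 1 :> R.
  by rewrite ler_pdivrMr // mul1r ler_ln ?posrE ?ler_nat // ltr0n ltnW.
set a := ln p%:R; set b := (ln y%:R)^-1; nra.
Qed.

Lemma trunc_log_le_ln (R : realType) (x : nat) :
  (0 < x)%N -> (trunc_log 2 x)%:R <= 2 * ln x%:R :> R.
Proof.
move=> x0; have H : 2 ^+ trunc_log 2 x <= x%:R :> R.
  by rewrite -natrX ler_nat trunc_logP.
have l2 : 2^-1 <= ln 2 :> R.
  have := @le_ln1Dx R (- 2^-1) _; rewrite ltrN2 invf_lt1 ?ltr1n // => /(_ isT).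
  have -> : 1 - 2^-1 = 2^-1 :> R by lra.
  by rewrite lnV ?posrE //; lra.
have : ln (2 ^+ trunc_log 2 x) <= ln x%:R :> R.
  by rewrite ler_ln ?posrE ?exprn_gt0 ?ltr0n.
rewrite lnXn // -[ln 2 *+ _]mulr_natr; have := ler0n R (trunc_log 2 x); set k := _%:R; nra.
Qed.

(** Here [v] is half of [ln (ln x)], so that [expR (- v)] is [(ln x)^(-1/2)], the value of [h] used
    below. *)
Lemma nat_eq_expR_expR (R : realType) (V : R) :
  exists x0, forall x, (x0 <= x)%N -> exists2 v, V <= v & x%:R = expR (expR (2 * v)) :> R.
Proof.
exists (Num.bound (expR (expR (2 * V)))) => x lex.
have xV : expR (expR (2 * V)) <= x%:R.
  by rewrite (le_trans (ltW (archi_boundP (expR_ge0 _)))) // ler_nat.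
have x0 : 0 < x%:R :> R by rewrite (lt_le_trans _ xV) // expR_gt0.
have lx : expR (2 * V) <= ln x%:R by rewrite -[leLHS]expRK ler_ln ?posrE ?expR_gt0.
have lx0 : 0 < ln x%:R :> R by rewrite (lt_le_trans _ lx) // expR_gt0.
exists (ln (ln x%:R) / 2); last by rewrite mulrC divfK ?pnatr_eq0 // !lnK ?posrE.
by rewrite ler_pdivlMr // mulrC -[leLHS]expRK ler_ln ?posrE ?expR_gt0.
Qed.

(** An integer version of [(log x)^2], at least [(ln x)^2] for positive [x]. *)
Definition cutoff (x : nat) : nat := ((trunc_log 2 x).+1 ^ 2)%N.

(** At [h = expR (- v)] the sum over all avoiding primes up to [x] is at least [e * v - C], while by
    [sum_prime_inv_le] the primes up to the cutoff contribute only [O(ln v)]. *)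
Lemma avoiding_primes_inv_sum_unbounded (R : realType) (rs : seq nat) :
  uniq rs -> all (fun r => prime r && (4 < r)%N) rs ->
  forall K : R, exists x0, forall x, (x0 <= x)%N ->
    K <= \sum_(1 <= p < x.+1 | [&& prime p, avoids_one (rcons rs 3) p & (cutoff x < p)%N]) p%:R^-1.
Proof.
move=> urs prs K; have [e [C [e0 HC]]] := avoiding_primes_zeta_term_sum_ge R urs prs.
pose D : R := e / (16 * expR 1).
have D0 : 0 < D by rewrite divr_gt0 // mulr_gt0 ?expR_gt0.
(* Since ln z <= D z - ln D - 1, the contribution of the primes below the cutoff is at
   most half of e v, up to a constant. *)
have [x0 Hx0] := nat_eq_expR_expR (Num.max 4 ((K + C + expR 1 * (10 * D - ln D)) / (e / 2))).
exists (maxn x0 2) => x; rewrite geq_max => /andP[/Hx0[v vV xv] x2].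
have x1 := ltnW x2.
move: vV; rewrite ge_max => /andP[v4]; rewrite ler_pdivrMr ?divr_gt0 // => vK.
have lnx : ln x%:R = expR (2 * v) by rewrite xv expRK.
have h0 : 0 < expR (- v) by exact: expR_gt0.
have xR : 0 < x%:R :> R by rewrite ltr0n.
(* The left side is [expR (v - expR v)], and [v >= 4] makes this at most [expR (- 3) <= 1/4]. *)
have xh : x%:R `^ (- expR (- v)) / expR (- v) <= 4^-1.
  rewrite /powR gt_eqF // lnx mulNr -expRD (_ : - v + 2 * v = v); last by ring.
  rewrite -expRN opprK -expRD; apply: le_trans (_ : expR (- 3) <= _).
    rewrite ler_expR; have := @expR_ge1Dxn R v 1; rewrite (le_trans _ v4) // => /(_ isT) /=.
    rewrite (_ : (2`!)%:R = 2) //; nra.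
  rewrite expRN lef_pV2 ?posrE ?expR_gt0 //.
  by apply: le_trans (expR_ge1Dx _); lra.
have low := HC _ _ h0 x1 xh; rewrite expRK opprK in low.
have y1 : (1 < cutoff x)%N.
  rewrite /cutoff -[1%N]/(1 ^ 2)%N ltn_sqr ltnS.
  by rewrite trunc_log_gt0 //.
have up := sum_prime_inv_le R y1.
have yv : ln (cutoff x)%:R <= 4 + 4 * v.
  apply: le_trans (_ : ln ((3 * expR (2 * v)) ^+ 2) <= _).
    rewrite ler_ln ?posrE ?exprn_gt0 ?mulr_gt0 ?expR_gt0 ?ltr0n ?(ltnW y1) //.
    rewrite /cutoff natrX lerXn2r ?nnegrE ?mulr_ge0 ?expR_ge0 //.
    have := trunc_log_le_ln R x1; rewrite lnx -natr1.
    have := expR_ge1Dx (2 * v); lra.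
  rewrite lnXn ?mulr_gt0 ?expR_gt0 // lnM ?posrE ?expR_gt0 // expRK.
  have : ln 3 <= 2 :> R by have := @le_ln1Dx R 2; rewrite (_ : 1 + 2 = 3); [apply|]; lra.
  lra.
have ub : ln (2 * (1 + ln (cutoff x)%:R)) <= D * (10 + 8 * v) - ln D.
  have z0 : 0 < 2 * (1 + ln (cutoff x)%:R) :> R.
    by rewrite mulr_gt0 // addr_gt0 // ln_gt0 // ltr1n.
  rewrite lerBrDr -lnM ?posrE //.
  apply: le_trans (_ : _ <= 2 * (1 + ln (cutoff x)%:R) * D) _; last by nra.
  have := @le_ln1Dx R (2 * (1 + ln (cutoff x)%:R) * D - 1).
  have -> (a : R) : 1 + (a - 1) = a by ring.
  move=> H; apply: le_trans (H _) _; last by lra.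
  by rewrite ltrBrDl subrr mulr_gt0.
have E1 : 0 < expR 1 :> R by exact: expR_gt0.
have ED : expR 1 * D = e / 16.
  by rewrite /D; field; rewrite gt_eqF.
have up2 := le_trans up (ler_wpM2l (ltW E1) ub).
have split : \sum_(1 <= p < x.+1 | prime p && avoids_one (rcons rs 3) p) zeta_term (expR (- v)) p
   <= \sum_(1 <= p < x.+1 | [&& prime p, avoids_one (rcons rs 3) p & (cutoff x < p)%N]) p%:R^-1
     + \sum_(1 <= p < (cutoff x).+1 | prime p) p%:R^-1.
  apply: le_trans (_ : \sum_(1 <= p < x.+1 | prime p && avoids_one (rcons rs 3) p) p%:R^-1 <= _).
    rewrite big_nat_cond [leRHS]big_nat_cond; apply: ler_sum => p /andP[/andP[p1 _] _].
    rewrite -powR_inv1 //; apply: ler_powR; first by rewrite ler1n.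
    lra.
  rewrite (bigID (fun p => cutoff x < p)%N) /=; apply: lerD.
    by rewrite le_eqVlt; apply/orP; left; apply/eqP; apply: eq_bigl => p; rewrite andbA.
  rewrite (big_nat_widen _ _ (maxn x.+1 (cutoff x).+1)) ?leq_maxl //.
  rewrite [leRHS](big_nat_widen _ _ (maxn x.+1 (cutoff x).+1)) ?leq_maxr //.
  rewrite big_mkcond [leRHS]big_mkcond; apply: ler_sum => p _.
  case: ifP => [/andP[/andP[/andP[-> _]]]|_]; last by case: ifP; rewrite ?invr_ge0.
  by rewrite -leqNgt -[(p <= _)%N]ltnS => ->.
have K1 : expR 1 * (D * (10 + 8 * v) - ln D) = e / 2 * v + expR 1 * (10 * D - ln D).
  have -> : e / 2 * v = 8 * (expR 1 * D) * v by rewrite ED; field.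
  by ring.
rewrite K1 in up2.
have := le_trans low split; set A := \sum_(_ <= _ < _ | _) _; lra.
Qed.

(** * Counting multiples and Turan's sieve *)

Lemma count_multiples (R : pzSemiRingType) (m x : nat) : (0 < m)%N ->
  \sum_(1 <= n < x.+1) (m %| n)%N%:R = (x %/ m)%:R :> R.
Proof.
move=> m0; rewrite -[RHS](_ : \sum_(1 <= k < (x %/ m).+1) 1 = _); last first.
  by rewrite sumr_const_nat subn1.
rewrite -(sum_multiples (fun=> 1 : R) xpredT) // [RHS]big_mkcond.
by apply: eq_bigr => n _; rewrite andbT; case: (m %| n)%N.
Qed.

Lemma divn_le_ratio (R : realFieldType) (x m : nat) : (x %/ m)%:R <= x%:R / m%:R :> R.
Proof.
case: m => [|m]; first by rewrite divn0 invr0 mulr0.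
by rewrite ler_pdivlMr ?ltr0n // -natrM ler_nat leq_divM.
Qed.

Lemma divn_ge_ratio (R : realFieldType) (x m : nat) : (0 < m)%N ->
  x%:R / m%:R - 1 <= (x %/ m)%:R :> R.
Proof.
move=> m0; rewrite lerBlDr natr1 ler_pdivrMr ?ltr0n // -natrM ler_nat.
by rewrite ltnW // ltn_ceil.
Qed.

(* Turan's second moment argument: the number of prime divisors in P has mean close to
   lambda := \sum_(p | P p) 1/p and variance O(lambda). *)
Lemma turan_sieve (R : realFieldType) (P : pred nat) (x : nat) :
  (forall p, P p -> prime p) ->
  (\sum_(1 <= p < x.+1 | P p) p%:R^-1) *
    \sum_(1 <= n < x.+1) (~~ has (fun p => P p && (p %| n)) (index_iota 1 x.+1))%N%:R
  <= 3 * x%:R :> R.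
Proof.
move=> Ppr; set l := (X in X * _ <= _); set Z := (X in _ * X <= _).
have l0 : 0 <= l by apply: sumr_ge0 => p _; rewrite invr_ge0.
pose W n : R := \sum_(1 <= p < x.+1 | P p) (p %| n)%N%:R.
(* Chebyshev's inequality: every [n] counted in [Z] has [W n = 0], hence deviation [l] from the
   mean. *)
have lZ : l ^+ 2 * Z <= \sum_(1 <= n < x.+1) (W n - l) ^+ 2.
  rewrite mulr_sumr; apply: ler_sum => n _.
  case: (boolP (has _ _)) => [_|/hasPn no]; first by rewrite mulr0 sqr_ge0.
  rewrite (_ : W n = 0) ?sub0r ?sqrrN ?mulr1 // /W big_seq_cond big1 // => p /andP[pin Pp].
  by have := no p pin; rewrite Pp /= => /negPf ->.
have W1 : l * x%:R - x%:R <= \sum_(1 <= n < x.+1) W n.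
  rewrite exchange_big /= mulr_suml.
  apply: le_trans (_ : \sum_(1 <= p < x.+1 | P p) (p%:R^-1 * x%:R - 1) <= _).
    rewrite sumrB lerD2l lerN2 big_mkcond.
    apply: le_trans (_ : \sum_(1 <= p < x.+1) 1 <= _); last by rewrite sumr_const_nat subn1.
    by apply: ler_sum => p _; case: ifP.
  apply: ler_sum => p Pp; have p0 := prime_gt0 (Ppr p Pp).
  by rewrite count_multiples // mulrC divn_ge_ratio.
have W2 : \sum_(1 <= n < x.+1) W n ^+ 2 <= x%:R * l ^+ 2 + x%:R * l.
  have -> : \sum_(1 <= n < x.+1) W n ^+ 2 = \sum_(1 <= p < x.+1 | P p)
      \sum_(1 <= q < x.+1 | P q) \sum_(1 <= n < x.+1) ((p %| n) && (q %| n))%N%:R.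
    under eq_bigr do rewrite expr2 /W big_distrlr /=.
    rewrite exchange_big; apply: eq_bigr => p _ /=; rewrite exchange_big.
    by apply: eq_bigr => q _ /=; apply: eq_bigr => n _; rewrite -natrM mulnb.
  rewrite expr2 big_distrlr /= !mulr_sumr -big_split /=.
  rewrite big_seq_cond [leRHS]big_seq_cond; apply: ler_sum => p /andP[pin Pp].
  have p0 := prime_gt0 (Ppr p Pp).
  apply: le_trans (_ : \sum_(1 <= q < x.+1 | P q)
      (x%:R * (p%:R^-1 * q%:R^-1) + (q == p)%:R * (x%:R * p%:R^-1)) <= _).
    apply: ler_sum => q Pq; have q0 := prime_gt0 (Ppr q Pq).
    have [->|qp] := eqVneq q p.
      under eq_bigr do rewrite andbb.
      rewrite count_multiples // mul1r (le_trans (divn_le_ratio _ _ _)) // lerDr.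
      by rewrite !mulr_ge0 ?invr_ge0.
    rewrite mul0r addr0 -invfM -natrM; apply: le_trans (divn_le_ratio _ _ _).
    rewrite -count_multiples ?muln_gt0 ?p0 //; apply: ler_sum => n _.
    rewrite Gauss_dvd // prime_coprime ?Ppr //.
    by rewrite dvdn_prime2 ?Ppr // eq_sym.
  rewrite big_split /= -mulr_sumr lerD2l -mulr_suml ler_piMl ?mulr_ge0 ?invr_ge0 //.
  rewrite big_mkcond (bigD1_seq p) ?iota_uniq //= Pp eqxx big1 ?addr0 // => q /negPf ->.
  by case: ifP.
(* Expanding the square gives at most [(x l^2 + x l) - 2 l (l x - x) + x l^2 = 3 l x]. *)
have : l ^+ 2 * Z <= 3 * l * x%:R.
  apply: le_trans lZ _; under eq_bigr do rewrite sqrrB.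
  rewrite big_split sumrB /= sumr_const_nat subn1 /= -[_ *+ x]mulr_natr.
  under [X in _ - X]eq_bigr do rewrite -[_ *+ 2]mulr_natr -mulrA.
  rewrite -mulr_suml; set A := (X in X <= _) in W2; set B := (X in _ <= X) in W1.
  rewrite -/A -/B.
  nra.
have [->|l1] := eqVneq l 0; first by rewrite mul0r mulr_ge0.
by move=> H; rewrite -(ler_pM2l (_ : 0 < l)) ?lt_def ?l1 //; lra.
Qed.

Lemma harmonic_le_ln (R : realType) (x : nat) : (0 < x)%N ->
  \sum_(1 <= k < x.+1) k%:R^-1 <= 1 + ln x%:R :> R.
Proof.
case: x => // x _; elim: x => [|x IHx]; first by rewrite big_nat1 invr1 ln1 addr0.
rewrite big_nat_recr //=; apply: le_trans (_ : _ <= 1 + ln x.+1%:R + x.+2%:R^-1) _.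
  by rewrite lerD2r.
rewrite -addrA lerD2l.
have n1 : x.+2%:R^-1 < 1 :> R by rewrite invf_lt1 // ltr1n.
have -> : x.+1%:R = x.+2%:R * (1 - x.+2%:R^-1) :> R.
  by rewrite mulrBr mulr1 mulfV ?pnatr_eq0 // -[x.+2]addn1 natrD addrK.
rewrite lnM ?posrE ?subr_gt0 ?ltr0n // -addrA gerDl.
have := @le_ln1Dx R (- x.+2%:R^-1); rewrite ltrN2 => /(_ n1).
by rewrite -lerBrDr sub0r.
Qed.

Definition isolated_prime (rs : seq nat) (a n p : nat) :=
  [&& prime p, (a < p)%N, avoids_one rs p, (p %| n)%N, ~~ (p ^ 2 %| n)%N
    & all (fun d => (d == 1 %[mod p]) ==> (d == 1)) (divisors n)].

(** A prime of [P] dividing [n] exceeds [a] but is not isolated, so either its square divides [n] or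
    some [d = 1 + k * p > 1] does; such a [d] is coprime to [p], whence [p * d] divides [n]. *)
Lemma isolated_prime_exceptions_sum (R : realType) (rs : seq nat) (a x n : nat) (y := cutoff x)
  (P := fun p => [&& prime p, avoids_one rs p & (y < p)%N]) :
  (a <= y)%N -> (0 < n <= x)%N -> ~ (exists p, isolated_prime rs a n p) ->
  1 <= (~~ has (fun p => P p && (p %| n)) (index_iota 1 x.+1))%N%:R +
    \sum_(1 <= p < x.+1 | P p) ((p ^ 2 %| n)%N%:R +
      \sum_(1 <= k < x.+1) (p * (1 + k * p) %| n)%N%:R) :> R.
Proof.
move=> ay /andP[n0 nx] no.
have S0 : 0 <= \sum_(1 <= p < x.+1 | P p) ((p ^ 2 %| n)%N%:R +
      \sum_(1 <= k < x.+1) (p * (1 + k * p) %| n)%N%:R) :> R.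
  by apply: sumr_ge0 => p _; rewrite addr_ge0 // sumr_ge0.
case: (boolP (has _ _)) => [/hasP[p pin /andP[Pp pn]]|_]; last by rewrite lerDl.
rewrite add0r big_mkcond (bigD1_seq p) ?iota_uniq //= Pp.
apply: le_trans (_ : _ <= (p ^ 2 %| n)%N%:R + \sum_(1 <= k < x.+1) (p * (1 + k * p) %| n)%N%:R) _; last first.
  by rewrite lerDl; apply: sumr_ge0 => q _; case: ifP => // _; rewrite addr_ge0 // sumr_ge0.
have [pp2|pp2] := boolP (p ^ 2 %| n)%N; first by rewrite lerDl sumr_ge0.
rewrite add0r; case/and3P: Pp => pp av yp; have p0 := prime_gt0 pp.
have : ~~ all (fun d => (d == 1 %[mod p]) ==> (d == 1))%N (divisors n).
  apply/negP => al; apply: no; exists p; rewrite /isolated_prime pp av pn pp2 al andbT /=.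
  by rewrite (leq_ltn_trans ay).
case/allPn => d; rewrite -dvdn_divisors // negb_imply => dn /andP[d1 dne].
have d0 := dvdn_gt0 n0 dn; have dle := dvdn_leq n0 dn.
have dgt : (1 < d)%N by rewrite ltn_neqAle eq_sym dne d0.
move: d1; rewrite eqn_mod_dvd // => /dvdnP[k kE].
have dE : d = (1 + k * p)%N by rewrite -kE; lia.
have k0 : (0 < k)%N by case: k kE dE => // _ dE; rewrite dE in dgt.
have kx : (k <= x)%N.
  have := leq_pmulr k p0; lia.
rewrite (bigD1_seq k) ?iota_uniq ?mem_index_iota ?k0 ?ltnS //=.
rewrite -dE Gauss_dvd; last first.
  by rewrite dE prime_coprime // dvdn_addl ?dvdn_mull // dvdn1 gtn_eqF // prime_gt1.
by rewrite pn dn /= lerDl sumr_ge0.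
Qed.

Lemma ln_le_trunc_log (R : realType) (x : nat) : (0 < x)%N -> ln x%:R <= (trunc_log 2 x).+1%:R :> R.
Proof.
move=> x0; have H : x%:R <= 2 ^+ (trunc_log 2 x).+1 :> R.
  by rewrite -natrX ler_nat ltnW // trunc_log_ltn.
have l2 : ln 2 <= 1 :> R.
  by have := @le_ln1Dx R 1; rewrite (_ : 1 + 1 = 2); [apply|]; lra.
apply: le_trans (_ : ln (2 ^+ (trunc_log 2 x).+1) <= _).
  by rewrite ler_ln ?posrE ?exprn_gt0 ?ltr0n.
by rewrite lnXn // -[leRHS]mulr1 mulr_natl lerMn2r l2 orbT.
Qed.

Lemma sum_inv_sq_le (R : realType) (P : pred nat) (x y : nat) : (0 < y)%N ->
  (forall p, P p -> (y < p)%N) -> \sum_(1 <= p < x.+1 | P p) (p%:R ^+ 2)^-1 <= y%:R^-1 :> R.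
Proof.
move=> y0 Py; apply: le_trans (_ : \sum_(y.+1 <= p < x.+1) zeta_term 1 p <= _); last first.
  by apply: le_trans (sum_zeta_term_tail _ _ _) _ => //; rewrite powR_inv1 // divr1.
have [xy|yx] := leqP x y.
  rewrite big_nat_cond big_pred0 ?big_geq // => p; rewrite ltnS.
  by apply/negP => /andP[/andP[_ px] /Py]; rewrite ltnNge (leq_trans px).
rewrite (big_cat_nat (n := y.+1)) //=; last exact: ltnW.
rewrite big_nat_cond big_pred0 ?add0r => [|p]; last first.
  by rewrite ltnS; apply/negP => /andP[/andP[_ py] /Py]; rewrite ltnNge py.
rewrite big_mkcond; apply: ler_sum_nat => p /andP[yp _]; case: ifP => _; last exact: zeta_term_ge0.
rewrite /zeta_term -powR_mulrn // -powRN; apply: ler_powR; first by rewrite ler1n (leq_trans _ yp).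
by rewrite lerN2; lra.
Qed.

(** Since [p * (1 + k * p) >= k * p^2], it has at most [x / (k p^2)] multiples up to [x]; summing
    over [k] gives the harmonic sum, and summing over [p > y] gives [1 / y]. *)
Lemma sum_shifted_multiples_le (R : realType) (P : pred nat) (x y : nat) : (0 < y)%N -> (0 < x)%N ->
  (forall p, P p -> (y < p)%N) ->
  \sum_(1 <= n < x.+1) \sum_(1 <= p < x.+1 | P p) ((p ^ 2 %| n)%N%:R +
      \sum_(1 <= k < x.+1) (p * (1 + k * p) %| n)%N%:R)
  <= x%:R * (2 + ln x%:R) / y%:R :> R.
Proof.
move=> y0 x0 Py; rewrite exchange_big /=.
apply: le_trans (_ : \sum_(1 <= p < x.+1 | P p) x%:R * (2 + ln x%:R) * (p%:R ^+ 2)^-1 <= _); last first.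
  rewrite -mulr_sumr; apply: ler_wpM2l; last exact: sum_inv_sq_le.
  by rewrite mulr_ge0 // addr_ge0 // ln_ge0 // ler1n.
apply: ler_sum => p /Py yp; have p0 : (0 < p)%N by exact: leq_ltn_trans yp.
have pR : 0 < p%:R :> R by rewrite ltr0n.
rewrite big_split /= exchange_big /=.
have -> : x%:R * (2 + ln x%:R) * (p%:R ^+ 2)^-1 =
    x%:R / (p ^ 2)%:R + (1 + ln x%:R) * (x%:R * (p%:R ^+ 2)^-1) :> R.
  by rewrite natrX; ring.
apply: lerD; first by rewrite count_multiples ?expn_gt0 ?p0 // divn_le_ratio.
apply: le_trans (_ : \sum_(1 <= k < x.+1) k%:R^-1 * (x%:R * (p%:R ^+ 2)^-1) <= _); last first.
  by rewrite -mulr_suml ler_wpM2r ?harmonic_le_ln // mulr_ge0 // invr_ge0 exprn_ge0.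
apply: ler_sum_nat => k /andP[k0 _].
rewrite count_multiples ?muln_gt0 ?p0 //; apply: le_trans (divn_le_ratio _ _ _) _.
rewrite mulrCA ler_wpM2l // -invfM lef_pV2 ?posrE ?ltr0n ?muln_gt0 ?p0 //.
  by rewrite -natrX -natrM ler_nat; lia.
by rewrite mulr_gt0 ?exprn_gt0 ?ltr0n.
Qed.

Lemma isolated_prime_exceptions_density (R : realType) (rs : seq nat) (a : nat) (Z : pred nat) :
  uniq rs -> all (fun r => prime r && (4 < r)%N) rs ->
  (forall n, (0 < n)%N -> Z n -> ~ exists p, isolated_prime (rcons rs 3) a n p) ->
  forall e : R, 0 < e -> exists x0, forall x, (x0 <= x)%N ->
    \sum_(1 <= n < x.+1) (Z n)%:R <= e * x%:R.
Proof.
move=> urs prs Zno e e0.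
(* With the sum of reciprocals at least [6 / e], Turan's bound leaves at most [e / 2 * x]. The other
   exceptions number at most [x (2 + ln x) / L^2 <= 3 x / L], again at most [e / 2 * x] since
   [L >= 6 / e]. *)
have [x0 Hx0] := avoiding_primes_inv_sum_unbounded urs prs (6 / e).
exists (maxn x0 (2 ^ maxn a (Num.bound (6 / e)))) => x; rewrite geq_max => /andP[/Hx0 lx xL].
have x1 : (0 < x)%N by apply: leq_trans xL; rewrite expn_gt0.
have := trunc_log_max (ltnSn 1) xL; rewrite geq_max => /andP[aL eL].
have {}eL : 6 / e <= (trunc_log 2 x).+1%:R.
  apply: le_trans (ltW (archi_boundP _)) _; first by rewrite divr_ge0 // ltW.
  by rewrite ler_nat leqW.
have lnL := ln_le_trunc_log R x1.
have y0 : (0 < cutoff x)%N by rewrite /cutoff expn_gt0.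
have ay : (a <= cutoff x)%N by rewrite /cutoff; nia.
set P := fun p => [&& prime p, avoids_one (rcons rs 3) p & (cutoff x < p)%N].
apply: le_trans (_ : \sum_(1 <= n < x.+1)
  ((~~ has (fun p => P p && (p %| n)) (index_iota 1 x.+1))%N%:R +
    \sum_(1 <= p < x.+1 | P p) ((p ^ 2 %| n)%N%:R +
      \sum_(1 <= k < x.+1) (p * (1 + k * p) %| n)%N%:R)) <= _).
  apply: ler_sum_nat => n /andP[n0 nx].
  have rhs0 : 0 <= (~~ has (fun p => P p && (p %| n)) (index_iota 1 x.+1))%N%:R +
    \sum_(1 <= p < x.+1 | P p) ((p ^ 2 %| n)%N%:R +
      \sum_(1 <= k < x.+1) (p * (1 + k * p) %| n)%N%:R) :> R.
    by rewrite addr_ge0 // sumr_ge0 // => p _; rewrite addr_ge0 // sumr_ge0.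
  case: (boolP (Z n)) => //= /(Zno n n0); apply: isolated_prime_exceptions_sum => //.
  by rewrite n0.
rewrite big_split /=.
have Ppr p : P p -> prime p by case/and3P.
have Py p : P p -> (cutoff x < p)%N by case/and3P.
have T := turan_sieve R x Ppr; have S := sum_shifted_multiples_le R y0 x1 Py.
set A := (X in _ * X <= _) in T; set B := (X in X <= _) in S.
rewrite -/A -/B.
set l := (X in X * _ <= _) in T; rewrite -/l in lx.
have A0 : 0 <= A by apply: sumr_ge0.
have xR : 0 < x%:R :> R by rewrite ltr0n.
have hA : A <= e / 2 * x%:R.
  rewrite -(ler_pM2l (_ : 0 < 6 / e)) ?divr_gt0 //.
  have -> : 6 / e * (e / 2 * x%:R) = 3 * x%:R by field; rewrite gt_eqF.
  by apply: le_trans T; rewrite ler_wpM2r.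
have hB : B <= e / 2 * x%:R.
  apply: le_trans S _; rewrite /cutoff natrX.
  set L := (trunc_log 2 x).+1%:R in eL lnL *.
  have L1 : 1 <= L by rewrite /L ler1n.
  rewrite ler_pdivrMr ?exprn_gt0 ?(lt_le_trans ltr01) //.
  have : 6 <= L * e by rewrite -ler_pdivrMr.
  move=> eL6; rewrite [leRHS](_ : _ = x%:R * (e / 2 * L ^+ 2)); last by ring.
  rewrite ler_pM2l //; nra.
lra.
Qed.

(** * Groups generated by elements of odd order *)

Local Close Scope ring_scope.
Local Open Scope group_scope.

(** If [p] divided the order of [K] exactly once, a normal Sylow subgroup [P] of order [p] would be
    a direct factor of [K], and the generators would all lie in its complement. *)
Lemma coprime_generated_not_dvdn (gT : finGroupType) (S : {set gT}) (p : nat) :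
  prime p -> (forall s, s \in S -> coprime #[s] (p * p.-1)) ->
  (forall d, d %| #|<<S>>| -> d = 1 %[mod p] -> d = 1%N) ->
  p %| #|<<S>>| -> p ^ 2 %| #|<<S>>|.
Proof.
move=> pr Sp d1 pK; apply: contraT => pK2; set K := <<S>>%G.
have SK s : s \in S -> s \in K by move=> sS; rewrite mem_gen.
have /normal_sylowP[P sylP nPK] : #|'Syl_p(K)| == 1%N.
  apply/eqP/d1; first exact: card_Syl_dvd.
  by rewrite card_Syl_mod // modn_small // prime_gt1.
have cardP : #|P| = p.
  rewrite (card_Hall sylP) p_part; case: (logn p #|K|) (pfactor_dvdn 2 pr (cardG_gt0 K))
    (pfactor_dvdn 1 pr (cardG_gt0 K)) => [|[|k]] //=.
    by rewrite expn1 pK.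
  by rewrite (negPf pK2).
have cycP : cyclic P by rewrite prime_cyclic // cardP.
have [sPK nKP] := andP nPK.
(* A generator acts on [P] with order dividing both its own order and [p.-1], the order of
   [Aut P]. *)
have cPK : K \subset 'C(P).
  rewrite gen_subG; apply/fintype.subsetP => s sS.
  have sN : s \in 'N(P) := fintype.subsetP nKP s (SK s sS).
  suff : s \in 'ker (conj_aut P) by rewrite ker_conj_aut.
  apply/kerP => //; apply/eqP.
  rewrite -order_eq1 -dvdn1 -(eqP (Sp s sS)) dvdn_gcd morph_order //= dvdn_mull //.
  have <- : #|Aut P| = p.-1 by rewrite card_Aut_cyclic // cardP totient_prime.
  by rewrite order_dvdG // (fintype.subsetP (Aut_conj_aut P 'N(P))) // mem_morphim.
have /splitsP[C /complP[tiPC PC]] := SchurZassenhaus_split (pHall_Hall sylP) nPK.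
have sCK : C \subset K by rewrite -PC mulG_subr.
have nCK : K \subset 'N(C).
  rewrite -{1}PC mul_subG ?normG // cents_norm // centsC.
  exact: fintype.subset_trans sCK cPK.
have cardKC : #|K / C| = p.
  rewrite card_quotient // -divgS // -PC TI_cardMg // mulnK // cardG_gt0 //.
(* The image of a generator in [K / C] has order dividing [p] and coprime to [p]. *)
have SC : S \subset C.
  apply/fintype.subsetP => s sS; have sN := fintype.subsetP nCK s (SK s sS).
  apply: coset_idr => //; apply/eqP; rewrite -order_eq1 -dvdn1 -(eqP (Sp s sS)) dvdn_gcd.
  rewrite morph_order //= dvdn_mulr // -cardKC order_dvdG //.
  exact/mem_quotient/SK.
have KC : K \subset C by rewrite gen_subG.
move: tiPC; rewrite (finset.setIidPl (fintype.subset_trans sPK KC)) => P1.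
by move: cardP pr; rewrite P1 cards1 => <-.
Qed.

(** The range runs from 5 to [a + 4] and so contains all primes from 5 to [a]; the prime 3 is
    appended by [rcons] where the list is used. *)
Definition small_odd_primes (a : nat) := [seq r <- iota 5 a | prime r].

(** The order of a generator is at most [a < p], hence coprime to [p]. A prime shared with [p.-1]
    would be odd and at most [a], against [avoids_one]. *)
Lemma generated_no_isolated_prime (gT : finGroupType) (S : {set gT}) (a p : nat) :
  (forall s, s \in S -> odd #[s] && (#[s] <= a)) ->
  ~~ isolated_prime (rcons (small_odd_primes a) 3) a #|<<S>>| p.
Proof.
move=> Sa; apply/negP => /and5P[pr ap /allP av pK /andP[pK2 /allP d1]].
case/negP: pK2; apply: coprime_generated_not_dvdn => // [s sS|d dK /eqP dp].
  have /andP[odds sa] := Sa s sS.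
  rewrite coprimeMr coprime_sym prime_coprime //.
  rewrite gtnNdvd ?order_gt0 //=; last exact: leq_ltn_trans ap.
  apply: contraT => ncop; have g1 : (1 < gcdn #[s] p.-1)%N.
    by rewrite ltn_neqAle eq_sym gcdn_gt0 order_gt0 andbT.
  have [q pq] := pdivP g1; rewrite dvdn_gcd => /andP[qs qp].
  have oddq : odd q := dvdn_odd qs odds.
  have qa : (q <= a)%N := leq_trans (dvdn_leq (order_gt0 s) qs) sa.
  have /av : q \in rcons (small_odd_primes a) 3.
    rewrite mem_rcons inE mem_filter pq mem_iota /=.
    by case: q pq oddq qa {qs qp} => [|[|[|[|[|q]]]]] //= _ _ qa; lia.
  by rewrite eqn_mod_dvd ?prime_gt0 // subn1 qp.
by apply/eqP/(implyP (d1 d _)); rewrite // -dvdn_divisors // cardG_gt0.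
Qed.

(** * Local actions and vertex orbits *)

Lemma stab_sub_norm_nbhd (Gamma : sgraph) (G : {group {perm Gamma}}) (u : Gamma) :
  G \subset graph_aut Gamma -> 'C_G[u | 'P] \subset 'N(nbhd u | 'P).
Proof.
move=> /fintype.subsetP aG; apply/fintype.subsetP => x /finset.setIP[/aG /graph_autP ax /astab1P xu].
move: xu; rewrite /= apermE => xu; apply/astabsP => w.
by rewrite /= apermE !inE -{1}xu ax.
Qed.

(* An odd-order element of the local group is the image of the 2'-part of any of its
   preimages in the stabiliser. *)
Lemma odd_core_stab_transitive (Omega : finType) (L : {group {perm Omega}})
    (Gamma : sgraph) (G : {group {perm Gamma}}) (u : Gamma) :
  G \subset graph_aut Gamma -> [transitive odd_core L, on [set: Omega] | 'P] ->
  perm_isomorphic (nbhd u) (local_group G u) L ->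
  forall w w', w \in nbhd u -> w' \in nbhd u ->
    exists2 h, h \in odd_core 'C_G[u | 'P] & h w = w'.
Proof.
move=> aG trL [f [phi [injf imf isoL fphi]]] w w'.
have nG := stab_sub_norm_nbhd u aG.
set Gu := 'C_G[u | 'P]%G in isoL nG *; set r := restr_perm (nbhd u).
have HL : odd_core L \subset L.
  by rewrite gen_subG; apply/fintype.subsetP => s; rewrite inE => /andP[].
have HG : odd_core Gu \subset Gu.
  by rewrite gen_subG; apply/fintype.subsetP => s; rewrite inE => /andP[].
have core : phi @* odd_core L \subset r @* odd_core Gu.
  rewrite morphim_gen; last by apply/fintype.subsetP => s; rewrite inE => /andP[].
  rewrite gen_subG; apply/fintype.subsetP => _ /morphimP[s _ + ->].
  rewrite inE => /andP[sL odds].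
  have : phi s \in r @* Gu.
    have [_ imphi] := isomP isoL.
    rewrite -[r @* Gu]/(local_group G u : {set _}) -imphi.
    exact: mem_morphim.
  case/morphimP => x xN xG phisE.
  have podd : 2^'.-elt (phi s).
    rewrite /p_elt -odd_2'nat; apply: dvdn_odd odds; exact: morph_order.
  rewrite -(constt_p_elt podd) phisE -morph_constt //.
  apply: mem_morphim; first exact: groupX.
  rewrite mem_gen // inE groupX //= odd_2'nat; exact: p_elt_constt.
rewrite -imf => /imsetP[o _ ->] /imsetP[o' _ ->].
have [s sL so] := atransP2 trL (finset.in_setT o) (finset.in_setT o').
have sL' := fintype.subsetP HL s sL.
have /morphimP[h hN hH hE] := fintype.subsetP core _ (mem_morphim phi sL' sL).
exists h => //; rewrite so /= apermE fphi // hE restr_permE //.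
by rewrite -imf imset_f.
Qed.

(** The union of the two orbits is closed under adjacency: a neighbour of [k u] is carried by the
    inverse of [k] to a neighbour of [u], which lies in the orbit of [v]; similarly with [u] and [v]
    exchanged. *)
Lemma two_orbits (Gamma : sgraph) (K : {group {perm Gamma}}) (u v : Gamma) :
  graph_connected Gamma -> K \subset graph_aut Gamma -> adj u v ->
  (forall w, adj u w -> exists2 h, h \in K & h v = w) ->
  (forall w, adj v w -> exists2 h, h \in K & h u = w) ->
  forall x, x \in orbit 'P K u :|: orbit 'P K v.
Proof.
move=> conn /fintype.subsetP aK uv trv tru x.
have sym : connect_sym (@adj Gamma) by apply: sym_connect_sym; exact: adj_sym.
have cl : fingraph.closed (@adj Gamma) (mem (orbit 'P K u :|: orbit 'P K v)).
  apply: intro_closed => // y z yz.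
  have step u0 v0 : (forall w, adj u0 w -> exists2 h, h \in K & h v0 = w) ->
      y \in orbit 'P K u0 -> z \in orbit 'P K v0.
    move=> tr /orbitP[k kK /=]; rewrite apermE => ky.
    have /tr[h hK hv] : adj u0 (k^-1 z).
      have /graph_autP <- := aK k kK; by rewrite permKV ky.
    apply/orbitP; exists (h * k); first by rewrite groupM.
    by rewrite /= apermE permM hv permKV.
  rewrite !inE => /orP[yu|yv]; first by rewrite (step u v) ?orbT.
  by rewrite (step v u).
by have := closed_connect cl (conn u x); rewrite !inE orbit_refl /= => <-.
Qed.

(** Orbit-stabiliser: with stabilisers of orders [i] and [j], a single orbit gives the fraction
    [d / c = 1 / i], and two orbits give [(i + j) / (i j)]. *)
Lemma card_two_orbits (Gamma : finType) (K : {group {perm Gamma}}) (u v : Gamma) (a : nat) :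
  (forall x, x \in orbit 'P K u :|: orbit 'P K v) ->
  #|'C_K[u | 'P]| <= a -> #|'C_K[v | 'P]| <= a ->
  exists c d, [/\ 0 < c <= a ^ 2, 0 < d <= 2 * a & #|Gamma| * c = #|K| * d]%N.
Proof.
move=> cov; set i := #|_|; set j := #|_| => ia ja.
have i0 : 0 < i by exact: cardG_gt0.
have j0 : 0 < j by exact: cardG_gt0.
have Ku : (#|orbit 'P K u| * i)%N = #|K| := card_orbit_stab 'P K u.
have Kv : (#|orbit 'P K v| * j)%N = #|K| := card_orbit_stab 'P K v.
have covE : #|Gamma| = #|orbit 'P K u :|: orbit 'P K v|.
  by rewrite -cardsT; apply: eq_card => x; rewrite finset.in_setT cov.
have [vu|vu] := boolP (v \in orbit 'P K u).
  exists i, 1%N; split; [nia | lia |].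
  by rewrite covE (orbit_eqP vu) finset.setUid Ku muln1.
exists (i * j)%N, (j + i)%N; split; [nia | lia |].
have dis : orbit 'P K u :&: orbit 'P K v = finset.set0.
  apply/eqP; rewrite finset.setI_eq0; apply: contraR vu => /pred0Pn[x /andP[/= xu xv]].
  by rewrite -(orbit_transl u xv).
by rewrite covE cardsU dis cards0 subn0 mulnDl mulnDr mulnA Ku [(i * j)%N]mulnC mulnA Kv.
Qed.

(** [S] consists of the odd-order elements of the stabilisers of [u] and [v]. Since it generates a
    subgroup of [G], the bound [a] also holds for the stabilisers in this subgroup. *)
Lemma locally_pair_order (Omega1 Omega2 : finType)
    (L1 : {group {perm Omega1}}) (L2 : {group {perm Omega2}})
    (Gamma : sgraph) (G : {group {perm Gamma}}) (a : nat) :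
  [transitive odd_core L1, on [set: Omega1] | 'P] ->
  [transitive odd_core L2, on [set: Omega2] | 'P] ->
  locally_pair L1 L2 G -> (forall v : Gamma, #|'C_G[v | 'P]| <= a) ->
  exists S : {set {perm Gamma}}, (forall s, s \in S -> odd #[s] && (#[s] <= a)) /\
    exists c d, [/\ 0 < c <= a ^ 2, 0 < d <= 2 * a & #|Gamma| * c = #|<<S>>| * d]%N.
Proof.
move=> tr1 tr2 [conn aG [u [v [uv iso1 iso2]]]] Ga.
pose odd_part w := [set x in 'C_G[w | 'P] | odd #[x]].
exists (odd_part u :|: odd_part v); split.
  move=> s /finset.setUP[]; rewrite inE => /andP[sG odds]; rewrite odds /=;
    by apply: leq_trans (dvdn_leq (cardG_gt0 _) (order_dvdG sG)) (Ga _).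
set K := <<odd_part u :|: odd_part v>>%G; have KG : K \subset G.
  by rewrite gen_subG; apply/fintype.subsetP => s /finset.setUP[]; rewrite inE => /andP[/finset.setIP[]].
have stabK w : #|'C_K[w | 'P]| <= a.
  by apply: leq_trans (Ga w); rewrite subset_leq_card // finset.setSI.
apply: card_two_orbits (stabK u) (stabK v).
apply: two_orbits (uv) _ _ => //; first exact: fintype.subset_trans KG aG.
- move=> w uw; have [||h hH <-] := odd_core_stab_transitive aG tr1 iso1 (w := v) (w' := w).
  + by rewrite inE.
  + by rewrite inE.
  by exists h => //; apply: fintype.subsetP hH; rewrite genS // finset.subsetUl.
- move=> w vw; have [||h hH <-] := odd_core_stab_transitive aG tr2 iso2 (w := u) (w' := w).
  + by rewrite inE adj_sym.
  + by rewrite inE.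
  by exists h => //; apply: fintype.subsetP hH; rewrite genS // finset.subsetUr.
Qed.

(* Density of the set of orders *)
Local Close Scope group_scope.
Local Open Scope ring_scope.

Definition no_isolated_prime (a n : nat) : bool :=
  (0 < n)%N && `[< ~ exists p, isolated_prime (rcons (small_odd_primes a) 3) a n p >].

Lemma no_isolated_prime_density (R : realType) (a : nat) (e : R) : 0 < e ->
  exists x0, forall x, (x0 <= x)%N ->
    \sum_(1 <= n < x.+1) (no_isolated_prime a n)%:R <= e * x%:R.
Proof.
apply: (isolated_prime_exceptions_density (rs := small_odd_primes a) (a := a)).
- exact/filter_uniq/iota_uniq.
- by apply/allP => r; rewrite mem_filter mem_iota => /and3P[-> ].
by move=> n _ /andP[_ /asboolP].
Qed.

Lemma sum_eq_mul_le1 (R : numDomainType) (c m x : nat) : (0 < c)%N ->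
  \sum_(1 <= k < x.+1) ((k * c)%N == m)%:R <= 1 :> R.
Proof.
move=> c0.
have [/hasP[k kin /eqP km]|/hasPn no] := boolP (has (fun k => (k * c)%N == m) (index_iota 1 x.+1)).
  rewrite (bigD1_seq k) ?iota_uniq //= km eqxx big1 ?addr0 // => l.
  by rewrite -km eqn_pmul2r // => /negPf ->.
by rewrite big_seq big1 // => k /no /negPf ->.
Qed.

(** The number without an isolated prime is the order [N] of the generated group; [n] is tied to it
    only through a ratio with bounded numerator and denominator. *)
Lemma locally_pair_orders_no_isolated_prime (Omega1 Omega2 : finType)
    (L1 : {group {perm Omega1}}) (L2 : {group {perm Omega2}}) (a n : nat) :
  [transitive odd_core L1, on [set: Omega1] | 'P] ->
  [transitive odd_core L2, on [set: Omega2] | 'P] ->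
  (forall (Gamma : sgraph) (G : {group {perm Gamma}}),
      locally_pair L1 L2 G -> forall v : Gamma, #|'C_G[v | 'P]%g| <= a)%N ->
  locally_pair_orders L1 L2 n ->
  exists c d N, [/\ 0 < c <= a ^ 2, 0 < d <= 2 * a, (n * c = N * d)%N & no_isolated_prime a N]%N.
Proof.
move=> tr1 tr2 Ga [Gamma [<- [G pairG]]].
have [S [Sa [c [d [ca da E]]]]] := locally_pair_order tr1 tr2 pairG (Ga _ _ pairG).
exists c, d, #|<<S>>%g|; split=> //; rewrite /no_isolated_prime cardG_gt0 /=.
by apply/asboolP => -[p]; apply/negP/generated_no_isolated_prime.
Qed.

Theorem theorem4p3 (R : realType) (Omega1 Omega2 : finType)
    (L1 : {group {perm Omega1}}) (L2 : {group {perm Omega2}})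
    (trO1 : [transitive odd_core L1, on [set: Omega1] | 'P])
    (trO2 : [transitive odd_core L2, on [set: Omega2] | 'P])
    (restr : locally_restrictive L1 L2) :
  natural_density_zero R (locally_pair_orders L1 L2).
Proof.
have [a [a0 Ga]] := restr; set X := locally_pair_orders L1 L2.
(* [A] and [B] bound the [c] and [d] of the relation [k * c = N * d]; they are kept opaque until
   their values matter. *)
have [A AE] : exists A, A = (a ^ 2)%N by exists (a ^ 2)%N.
have [B BE] : exists B, B = (2 * a)%N by exists (2 * a)%N.
have A0 : (0 < A)%N by rewrite AE expn_gt0 a0.
have B0 : (0 < B)%N by rewrite BE muln_gt0 a0.
(* Each order [k] is charged to a triple [(c, d, N)], where [N <= N * d = k * c <= A * x];
   conversely [(c, d, N)] determines [k], so each [N] is charged at most [A * B] times. *)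
have X_le x : (\sum_(1 <= k < x.+1) (`[< X k >] : nat))%N%:R <=
    (A * B)%:R * \sum_(1 <= N < (A * x).+1) (no_isolated_prime a N)%:R :> R.
  rewrite natr_sum.
  apply: le_trans (_ : \sum_(1 <= k < x.+1) \sum_(1 <= c < A.+1) \sum_(1 <= d < B.+1)
     \sum_(1 <= N < (A * x).+1) (no_isolated_prime a N)%:R * ((k * c)%N == (N * d)%N)%:R <= _).
    apply: ler_sum_nat => k /andP[k0 kx].
    case: asboolP => [Xk|_]; last first.
      by rewrite mulr0n; repeat (apply: sumr_ge0 => ? _); apply: mulr_ge0.
    have [c [d [N [/andP[c0 cA] /andP[d0 dB] kN bad]]]] :=
      locally_pair_orders_no_isolated_prime trO1 trO2 Ga Xk.
    rewrite -AE in cA; rewrite -BE in dB.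
    have N0 : (0 < N)%N by case/andP: bad.
    have Nx : (N <= A * x)%N by nia.
    rewrite (bigD1_seq c) ?iota_uniq ?mem_index_iota ?c0 ?ltnS //=.
    rewrite (bigD1_seq d) ?iota_uniq ?mem_index_iota ?d0 ?ltnS //=.
    rewrite (bigD1_seq N) ?iota_uniq ?mem_index_iota ?N0 ?ltnS //=.
    rewrite bad kN eqxx mulr1 -!addrA lerDl.
    rewrite !addr_ge0 //; repeat (apply: sumr_ge0 => ? _); exact: mulr_ge0.
  rewrite exchange_big /=; apply: le_trans (_ : \sum_(1 <= c < A.+1) \sum_(1 <= d < B.+1)
    \sum_(1 <= N < (A * x).+1) (no_isolated_prime a N)%:R <= _); last first.
    by rewrite !sumr_const_nat !subn1 /= -mulrnA mulr_natl [(B * A)%N]mulnC.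
  apply: ler_sum_nat => c /andP[c0 _]; rewrite exchange_big /=; apply: ler_sum => d _.
  rewrite exchange_big /=; apply: ler_sum => N _.
  by rewrite -mulr_sumr ler_piMr // sum_eq_mul_le1.
rewrite /natural_density_zero; apply/cvgrPdist_le => e e0.
have AB : 0 < (A * B * A)%:R :> R by rewrite ltr0n !muln_gt0 A0 B0.
(* The proportion [e / (A * B * A)] compensates for the multiplicity [A * B] and for the range
   [A * n]. *)
have [x0 Hx0] := no_isolated_prime_density a (divr_gt0 e0 AB).
exists (maxn x0 1) => // n /=; rewrite geq_max => /andP[xn n0].
have nR : 0 < n%:R :> R by rewrite ltr0n.
rewrite sub0r normrN ger0_norm ?divr_ge0 // ler_pdivrMr //.
apply: le_trans (X_le n) _.
have /Hx0 : (x0 <= A * n)%N by nia.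
rewrite -(ler_pM2l (_ : 0 < (A * B)%:R)) ?ltr0n ?muln_gt0 ?A0 //.
move=> /le_trans; apply; rewrite le_eqVlt; apply/orP; left; apply/eqP.
by rewrite !natrM; field; rewrite !pnatr_eq0 -!lt0n A0 B0.
Qed.
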